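(* Let $p>1$, $\frac1p+\frac1{p'}=1$, $s_*\in(0,1)$. Let $f\in L^1(0,1)$ satisfy $f(0)=f(s_* )=f(1)=0$, $f<0$ on $(0,s_* )$, $f>0$ on $(s_*,1)$, with $f$ upper semicontinuous on $(0,s_* )$ and lower semicontinuous on $(s_*,1)$, and $$\int_0^1f(t)\,dt\ge0 .$$ Let $h:[0,1]\to\mathbb{R}$ be bounded, continuous at $s_*$, and such that there are points $0=k_0<k_1<\dots<k_q<k_{q+1}=1$ for which $h$ has jump discontinuities at $k_j$ ($j=1,\dots,q$) and $h|_{(k_j,k_{j+1})}\in C(k_j,k_{j+1})$ ($j=0,\dots,q$). Let $c_F,c_B\in[-\infty,+\infty]$ be the threshold speeds defined in the context. Then there exists $c\in\mathbb{R}$ for which the boundary value problem $$\begin{cases}y'(t)=p'\big[(c-h(t))(y^+(t))^{\frac1p}-f(t)\big], & \text{a.e. } t\in(0,1),\\ y(0)=0=y(1)\end{cases}$$ admits a unique positive solution $y=y(t)$ on $(0,1)$ if and only if $c_F<c_B$.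
   Context: $y^+(t)=\max\{y(t),0\}$. Solutions are in the sense of Carathéodory: absolutely continuous on the closed interval, satisfying the equation a.e. and the boundary conditions. A positive solution is one that is positive on the open interval. Threshold speeds. For $c\in\mathbb{R}$ consider the auxiliary problem on $[0,s_*]$: $y'(t)=p'[(c-h(t))(y(t))^{1/p}-f(t)]$ for a.e. $t\in(0,s_* )$, $y(0)=0=y(s_* )$, and the auxiliary problem on $[s_*,1]$: $y'(t)=p'[(c-h(t))(y(t))^{1/p}-f(t)]$ for a.e. $t\in(s_*,1)$, $y(s_* )=0=y(1)$. Then $c_F$ is the supremum of the set of $c\in\mathbb{R}$ for which the problem on $[0,s_*]$ has a positive solution, and $c_B$ is the infimum of the set of $c\in\mathbb{R}$ for which the problem on $[s_*,1]$ has a positive solution; both are elements of the extended real line, with $c_F=-\infty$ (resp. $c_B=+\infty$) if the corresponding set is empty. *)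

(* Defs.v *)
From mathcomp Require Import all_boot all_order all_algebra.
From mathcomp Require Import all_classical all_reals all_analysis.

Set Implicit Arguments.
Unset Strict Implicit.
Unset Printing Implicit Defensive.

Import Order.TTheory GRing.Theory Num.Theory.
Import numFieldNormedType.Exports.

Local Open Scope classical_set_scope.
Local Open Scope ring_scope.

(* Mirror image of the library's [lower_semicontinuous]. *)
Definition upper_semicontinuous (X : topologicalType) (R : numFieldType)
    (f : X -> \bar R) : Prop :=
  forall x a, (f x < a%:E)%E ->
    exists2 V, nbhs x V & forall y, V y -> (f y < a%:E)%E.

(* Semicontinuity of [f] restricted to [A]: points outside [A] are isolated in
   [subspace A], hence impose no condition. *)
Definition lsc_on (R : realType) (A : set R) (f : R -> R) : Prop :=
  @lower_semicontinuous (subspace A) R (EFin \o f).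

Definition usc_on (R : realType) (A : set R) (f : R -> R) : Prop :=
  @upper_semicontinuous (subspace A) R (EFin \o f).

Definition absolutely_continuous (R : realType) (a b : R) (F : R -> R) : Prop :=
  forall e : R, 0 < e -> exists2 d : R, 0 < d &
    forall (n : nat) (u v : 'I_n -> R),
      (forall i, [/\ a <= u i, u i <= v i & v i <= b]) ->
      trivIset [set: 'I_n] (fun i => [set` `]u i, v i[]) ->
      \sum_(i < n) (v i - u i) < d ->
      \sum_(i < n) `|F (v i) - F (u i)| < e.

(* [y] solves y' = g(t, y) on [a, b] in the sense of Caratheodory, vanishes at
   both end points and is positive in between. Only the values of [y] on [a, b]
   matter. *)
Definition positive_solution (R : realType) (g : R -> R -> R) (a b : R)
    (y : R -> R) : Prop :=
  [/\ absolutely_continuous a b y,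
      {ae (@lebesgue_measure R), forall t, t \in `]a, b[ ->
        is_derive t 1 y (g t (y t))},
      y a = 0, y b = 0 & forall t, t \in `]a, b[ -> 0 < y t].

Definition wave_rhs (R : realType) (p p' : R) (f h : R -> R) (c t v : R) : R :=
  p' * ((c - h t) * v `^ p^-1 - f t).

Definition wave_rhs_pos (R : realType) (p p' : R) (f h : R -> R) (c t v : R) :
    R :=
  wave_rhs p p' f h c t (Num.max v 0).

Definition speed_F (R : realType) (p p' s : R) (f h : R -> R) : \bar R :=
  ereal_sup [set c%:E | c in
    [set c : R | exists y, positive_solution (wave_rhs p p' f h c) 0 s y]].

Definition speed_B (R : realType) (p p' s : R) (f h : R -> R) : \bar R :=
  ereal_inf [set c%:E | c in
    [set c : R | exists y, positive_solution (wave_rhs p p' f h c) s 1 y]].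

(* Main.v *)
From HB Require Import structures.
Require Import Defs.
From mathcomp Require Import all_boot all_order all_algebra.
From mathcomp Require Import all_classical all_reals all_analysis.
From mathcomp Require Import measurable_realfun ring lra.

(** Away from its zeros, a solution [y] can be measured by the gauge
    [w = y ^ (1 - 1/p)], for which the equation becomes
    [w' = c - h - f y ^ (- 1/p)]: the speed enters additively, and where
    [f < 0] the right-hand side is nonincreasing in the unknown.  Two solutions
    on [[0, s]] issued from zero therefore cannot move apart faster than their
    speeds do: [w1 t - w2 t <= max (c1 - c2) 0 * t] ([front_gap]).  This single
    estimate contains uniqueness ([front_unique]), monotonicity in the speed,
    and Lipschitz dependence of the value at [s] on the speed.  The reflection
    [t -> 1 - t], with [c], [h], [f] changed into their opposites, carries
    [[s, 1]] to the same situation ([front_of_back], [back_of_front]).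

    Every speed [c] has exactly one front [Y c] on [[0, s]] with [Y c 0 = 0]
    that is positive inside, and exactly one such front on [[s, 1]] issued from
    1, the reflection of a front [Z c] on [[0, 1 - s]] ([front_exists]); only
    their values at [s] remain to be understood.
    In the gauge, the value [phi c] of the left front is nondecreasing in [c],
    the value [psi c] of the right one is nonincreasing, both are Lipschitz, and
    each tends to infinity at one end ([front_growth]).  A positive solution on
    [[0, 1]] is the same thing as a speed with [phi c = psi c > 0]; the speeds
    defining [c_F] are those with [phi c = 0], and those defining [c_B] are
    those with [psi c = 0].

    If a solution of speed [c] exists, the Lipschitz estimate for [phi] keeps
    the zeros of [phi] below [c] by the positive amount [phi c / s], and by
    monotonicity the zeros of [psi] are at least [c]; hence [c_F < c_B].
    Conversely [phi - psi] vanishes at some [c] by the intermediate value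
    theorem.  If the common value were zero, [c] would belong to both sets and
    [c_B <= c <= c_F].  So under [c_F < c_B] it is positive, and gluing the two
    fronts gives the solution, which is unique because each half is.

    The estimates rest on one tool, [absolutely_continuous_nonincreasing]: an
    absolutely continuous function with nonpositive derivative almost everywhere
    is nonincreasing.  Comparisons go through [nonpositive_of_derivative], which
    asks for the sign of the derivative only where the function is positive and
    small.  Existence of fronts is delicate only because [y ^ (1/p)] is not
    Lipschitz at zero.  Truncating the power from below at [2 ^- n] gives
    Lipschitz equations, solved by Picard iteration ([picard]); a small
    correction makes their solutions decrease with [n], and the limit solves the
    original equation by dominated convergence ([sublinear_existence]).
    Semicontinuity of [f] enters where this limit is shown to be positive: [f]
    is bounded away from zero near each interior point, so the solution cannot
    touch zero there. *)

Import Order.TTheory GRing.Theory Num.Theory.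
Import numFieldNormedType.Exports.

Local Open Scope classical_set_scope.
Local Open Scope ring_scope.

Set Implicit Arguments.
Unset Strict Implicit.
Unset Printing Implicit Defensive.

(** * Monotonicity of absolutely continuous functions *)

Lemma ae_impl (R : realType) (P Q : R -> Prop) :
  (forall t, P t -> Q t) -> {ae (@lebesgue_measure R), forall t, P t} ->
  {ae (@lebesgue_measure R), forall t, Q t}.
Proof.
by move=> PQ; apply: filterS => //; exact: (ae_filter_ringOfSetsType lebesgue_measure).
Qed.

Lemma ae_impl2 (R : realType) (P P' Q : R -> Prop) :
  (forall t, P t -> P' t -> Q t) -> {ae (@lebesgue_measure R), forall t, P t} ->
  {ae (@lebesgue_measure R), forall t, P' t} ->
  {ae (@lebesgue_measure R), forall t, Q t}.
Proof.
by move=> PQ; apply: filterS2 => //; exact: (ae_filter_ringOfSetsType lebesgue_measure).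
Qed.

(** The form of differentiability that bounds increments over intervals
    containing [t], which is what chaining intervals requires. *)
Lemma is_derive_approx (R : realType) (F : R -> R) (t d : R) :
  is_derive t 1 F d -> forall e : R, 0 < e -> exists2 r : R, 0 < r &
    forall z, `|z - t| < r -> `|F z - F t - d * (z - t)| <= e * `|z - t|.
Proof.
move=> [dF <-] e e0.
have := dF; rewrite /derivable => /cvgrPdist_le /(_ _ e0) [r /= r0 Hr].
exists r => // z zt.
have [->|zNt] := eqVneq z t; first by rewrite !subrr mulr0 subrr normr0 mulr0.
have zt0 : z - t != 0 by rewrite subr_eq0.
have := Hr (z - t); rewrite /= sub0r normrN => /(_ zt zt0).
rewrite /= [_ *: 1]mulr1 subrK -/(derive F t 1) => Hq.
rewrite -ler_pdivrMr ?normr_gt0//.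
rewrite -normfV -normrM -(normrN (_ * _)) (le_trans _ Hq)//.
rewrite le_eqVlt; apply/orP; left; apply/eqP; congr `|_|.
rewrite /GRing.scale/=.
by field.
Qed.

Lemma nbhs_dist (R : realType) (x : R) (P : set R) :
  nbhs x P -> exists2 r : R, 0 < r & forall z, `|z - x| < r -> P z.
Proof.
move=> /nbhs_ballP [r r0 rP]; exists r => // z zx; apply: rP.
by rewrite /ball/= distrC.
Qed.

(** Links the two notions of smallness: the total length in the definition of
    absolute continuity, and the measure of an open set around a null set. *)
Lemma measure_disjoint_itv_le (R : realType) (n : nat) (u v : 'I_n -> R) (U : set R) :
  measurable U ->
  (forall i, u i <= v i) ->
  trivIset [set: 'I_n] (fun i => [set` `]u i, v i[]) ->
  (forall i, [set` `]u i, v i[] `<=` U) ->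
  ((\sum_(i < n) (v i - u i))%:E <= @lebesgue_measure R U)%E.
Proof.
move=> mU uv tI sU.
have -> : ((\sum_(i < n) (v i - u i))%:E =
   \sum_(i < n) @lebesgue_measure R [set` `]u i, v i[])%E.
  rewrite -sumEFin; apply: eq_bigr => i _.
  rewrite lebesgue_measure_itv/= lte_fin; case: ltP => // vu.
  by rewrite (@le_anti _ _ (u i) (v i)) ?uv ?vu// subrr.
rewrite -(@measure_semi_additive_ord _ _ _ (@lebesgue_measure R))//.
- apply: le_measure; rewrite ?inE//.
    by apply: bigsetU_measurable.
  by elim/big_ind : _ => // A B AU BU; rewrite subUset.
- by apply: bigsetU_measurable.
Qed.

(** A creeping argument in the style of Cousin's lemma.  Around each point, an
    interval either has increment at most [e] times its length or lies in [U];
    chaining such intervals from [a] to [b] bounds the increment of [F] up to its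
    variation over finitely many disjoint intervals inside [U]. *)
Lemma interval_chain (R : realType) (a b e : R) (F : R -> R) (U : set R) :
  0 < e -> a <= b ->
  (forall t, a <= t <= b -> exists2 r : R, 0 < r & forall x y, t - r < x -> x <= t ->
     t <= y -> y < t + r -> F y - F x <= e * (y - x) \/ `]x, y[ `<=` U) ->
  exists (n : nat) (u v : nat -> R),
    [/\ forall i, (i < n)%N -> [/\ a <= u i, u i <= v i & v i <= b],
        forall i, (i < n)%N -> `]u i, v i[ `<=` U,
        forall i j, (i < j < n)%N -> v i <= u j &
        F b - F a <= e * (b - a) + \sum_(i < n) `|F (v i) - F (u i)|].
Proof.
move=> e0 ab loc.
pose P x := exists (n : nat) (u v : nat -> R),
    [/\ forall i, (i < n)%N -> [/\ a <= u i, u i <= v i & v i <= x],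
        forall i, (i < n)%N -> `]u i, v i[ `<=` U,
        forall i j, (i < j < n)%N -> v i <= u j &
        F x - F a <= e * (x - a) + \sum_(i < n) `|F (v i) - F (u i)|].
have Pstep x y : a <= x -> x <= y -> P x ->
    F y - F x <= e * (y - x) \/ `]x, y[ `<=` U -> P y.
  move=> ax xy [n [u [v [uv uvU vu Fx]]]] [Fxy|xyU].
    exists n, u, v; split=> //.
      by move=> i /uv[? ? vx]; split => //; rewrite (le_trans vx).
    by move: Fx Fxy; rewrite !mulrBr; lra.
  exists n.+1, (fun i => if i == n then x else u i),
    (fun i => if i == n then y else v i); split.
  - move=> i; rewrite ltnS leq_eqVlt; case: eqVneq => //= _ /uv[? ? vx].
    by split => //; rewrite (le_trans vx).
  - by move=> i; rewrite ltnS leq_eqVlt; case: eqVneq => //= _ /uvU.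
  - move=> i j /andP[ij]; rewrite ltnS leq_eqVlt.
    have [jn _|_ /= jn] := eqVneq j n.
      by rewrite jn in ij; rewrite ltn_eqF//; have [] := uv i ij.
    by rewrite ltn_eqF ?(ltn_trans ij)//; apply: vu; rewrite ij.
  - rewrite big_ord_recr/= eqxx.
    under eq_bigr => i _ do rewrite ltn_eqF//.
    have := ler_norm (F y - F x).
    have : e * (x - a) <= e * (y - a) by rewrite ler_pM2l// lerB.
    by move: Fx; lra.
have Pa : P a.
  exists 0%N, (fun=> a), (fun=> a); split => //.
  by rewrite big_ord0 !subrr mulr0 addr0.
(* The supremum of the reachable points is reached, and is [b]: the local
   property there crosses it in one step. *)
pose E := [set x | a <= x <= b /\ P x].
have E0 : E !=set0 by exists a; split => //; rewrite lexx.
have Eb : has_ubound E by exists b => x [/andP[]].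
have supE : has_sup E by [].
set s := sup E.
have as_ : a <= s by apply: (ub_le_sup Eb); split => //; rewrite lexx.
have sb : s <= b by apply: ge_sup => // x [/andP[]].
have [r r0 Hr] := loc s (introT andP (conj as_ sb)).
have [x [/andP[ax xb] Px] xs] := sup_adherent r0 supE.
have xs' : x <= s by apply: (ub_le_sup Eb); split => //; rewrite ax.
have key y : s <= y -> y < s + r -> P y.
  move=> sy ysr; apply: (Pstep x y) => //; first exact: le_trans sy.
  exact: Hr.
have [bs|bs] := leP b (s + r / 2).
  by apply: key => //; rewrite (le_lt_trans bs)// ltrD2l; lra.
suff : s + r / 2 <= s by lra.
apply: (ub_le_sup Eb); split; first by apply/andP; split; lra.
by apply: key; lra.
Qed.


(** The two end points are added to the null set because nothing is known
    about the derivative there. *)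
Lemma negligible_open_cover (R : realType) (N : set R) (a b d : R) :
  (@lebesgue_measure R).-negligible N -> 0 < d ->
  exists U : set R, [/\ open U, N `<=` U, U a, U b &
    (@lebesgue_measure R U < d%:E)%E].
Proof.
move=> nN d0.
have neg1 (x : R) : (@lebesgue_measure R).-negligible [set x].
  by exists [set x]; split => //; exact: lebesgue_measure_set1.
have [N' [mN' N'0 NN']] : (@lebesgue_measure R).-negligible (N `|` [set a] `|` [set b]).
  by do 2 apply: negligibleU => //.
have mfin : (@lebesgue_measure R N' < +oo)%E.
  by apply: (@eq_ind_r _ 0%E (fun z => (z < +oo)%E)); [exact: ltry|exact: N'0].
have [U [oU NU Ud]] := @lebesgue_regularity_outer R N' d mN' mfin d0.
have mU : measurable U by exact: open_measurable.
exists U; split => //.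
- by move=> x Nx; apply/NU/NN'; left; left.
- by apply/NU/NN'; left; right.
- by apply/NU/NN'; right.
- apply: le_lt_trans Ud; rewrite -[U in leLHS](setDUK NU).
  apply: (le_trans (measureU2 _ _ _)) => //; first exact: measurableD.
  set m := (X in (X + _ <= _)%E); have -> : m = 0%E by exact: N'0.
  by rewrite add0e.
Qed.

(** Cover the null set where the derivative is not controlled by an open set so
    small that [F] varies there by less than [e]; elsewhere increments are at
    most [e] times the length.  [interval_chain] adds the two contributions. *)
Lemma absolutely_continuous_nonincreasing (R : realType) (a b : R) (F : R -> R) :
  a <= b -> absolutely_continuous a b F ->
  {ae (@lebesgue_measure R), forall t, t \in `]a, b[ ->
     exists2 d : R, is_derive t 1 F d & d <= 0} ->
  F b <= F a.
Proof.
move=> ab acF nN.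
apply/ler_addgt0Pr => e' e'0.
(* Chosen so that [e * (b - a) + e = e']. *)
pose e := e' / (b - a + 1).
have ba1 : 0 < b - a + 1 by lra.
have e0 : 0 < e by rewrite divr_gt0.
have [d d0 Hd] := acF e e0.
have [U [oU NU Ua Ub Ud]] := @negligible_open_cover R _ a b d nN d0.
have mU : measurable U by exact: open_measurable.
have [|n [u [v [uv uvU vu Fab]]]] :=
    @interval_chain R a b e F U e0 ab.
  move=> t /andP[at_ tb].
  have [tU|tU] := pselect (U t).
    have [r r0 Hr] : exists2 r, 0 < r & forall z, `|z - t| < r -> U z.
      by apply: nbhs_dist; apply: open_nbhs_nbhs.
    exists r => // x y rx xt ty yr; right => z /=.
    rewrite in_itv/= => /andP[xz zy]; apply: Hr.
    by rewrite ltr_distl; apply/andP; split; lra.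
  have ta : a != t by apply/eqP => ta; apply: tU; rewrite -ta.
  have tb' : t != b by apply/eqP => tb'; apply: tU; rewrite tb'.
  have tab : t \in `]a, b[ by rewrite in_itv/= !lt_neqAle at_ tb ta tb'.
  have [D dF D0] : exists2 d : R, is_derive t 1 F d & d <= 0.
    by apply: contrapT => nd; apply: tU; apply: NU => /= /(_ tab).
  have [r r0 Hr] := @is_derive_approx R F t D dF e e0.
  exists r => // x y rx xt ty yr; left.
  have : `|x - t| < r by rewrite ltr_distl; apply/andP; split; lra.
  move=> /Hr; rewrite (ler0_norm (x := x - t)) ?subr_le0// => /ler_normlP[+ _].
  have : `|y - t| < r by rewrite ltr_distl; apply/andP; split; lra.
  move=> /Hr; rewrite (ger0_norm (x := y - t)) ?subr_ge0// => /ler_normlP[_ +].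
  have : D * (y - x) <= 0 by rewrite mulr_le0_ge0// subr_ge0 (le_trans xt).
  by rewrite !mulrBr !mulrN; lra.
have tI : trivIset [set: 'I_n] (fun i : 'I_n => [set` `]u i, v i[]).
  move=> i j _ _ [z /=]; rewrite !in_itv/= => -[/andP[uz zv] /andP[uz' zv']].
  have [ij|ji|] := ltngtP i j; last by move=> ij; exact: val_inj.
    have vu' : v i <= u j by apply: vu; rewrite ij ltn_ord.
    by have := lt_trans (lt_le_trans zv vu') uz'; rewrite ltxx.
  have vu' : v j <= u i by apply: vu; rewrite ji ltn_ord.
  by have := lt_trans (lt_le_trans zv' vu') uz; rewrite ltxx.
have Sd : \sum_(i < n) (v i - u i) < d.
  rewrite -lte_fin; apply: le_lt_trans Ud.
  apply: (@measure_disjoint_itv_le R n (fun i => u i) (fun i => v i)) => //.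
  - by move=> i; have [] := uv i (ltn_ord i).
  - by move=> i; apply: uvU.
have := Hd n (fun i => u i) (fun i => v i) (fun i => uv i (ltn_ord i)) tI Sd.
have -> : e' = e * (b - a) + e.
  by rewrite -[X in _ + X]mulr1 -mulrDr divfK// gt_eqF.
by move: Fab; lra.
Qed.

Lemma within_continuous_distP (R : realType) (a b : R) (F : R -> R) :
  {within `[a, b], continuous F} <->
  (forall x, a <= x <= b -> forall e : R, 0 < e -> exists2 d : R, 0 < d &
     forall y, a <= y <= b -> `|y - x| < d -> `|F y - F x| < e).
Proof.
rewrite subspace_continuousP; split => [cF x xab e e0|cF x].
  have /cvgrPdist_lt/(_ _ e0) : F @ within `[a, b] (nbhs x) --> F x.
    by apply: cF; rewrite /= in_itv.
  move=> /nbhs_dist[r r0 Hr]; exists r => // y yab yx.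
  by rewrite distrC; apply: Hr; rewrite //= in_itv.
rewrite /= in_itv/= => xab; apply/cvgrPdist_lt => e e0.
have [d d0 Hd] := cF x xab e e0.
apply/nbhs_ballP; exists d => // y xy; rewrite /= in_itv/= => yab.
by rewrite distrC; apply: Hd => //; rewrite distrC.
Qed.

(** A function that becomes positive has a last zero [t0] before doing so.  Just
    after [t0] it is positive and below [k], so it cannot increase.  Asking for
    the sign of the derivative only where [0 < D t < k] replaces a Gronwall
    estimate, and asking for absolute continuity only inside [0, b] admits
    powers of functions that vanish at the end points. *)
Lemma nonpositive_of_derivative (R : realType) (b k : R) (D : R -> R) :
  0 < k -> {within `[0, b], continuous D} -> D 0 <= 0 ->
  (forall u v, 0 < u -> u <= v -> v < b -> absolutely_continuous u v D) ->
  {ae (@lebesgue_measure R), forall t, t \in `]0, b[ ->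
     exists2 d : R, is_derive t 1 D d & (0 < D t < k -> d <= 0)} ->
  forall t, 0 <= t <= b -> D t <= 0.
Proof.
move=> k0 /within_continuous_distP cD D0 acD aeD t1 /andP[t10 t1b].
rewrite leNgt; apply/negP => Dt1.
pose E := [set t | 0 <= t <= t1 /\ D t <= 0].
have E0 : E 0 by split => //; rewrite lexx.
have Eb : has_ubound E by exists t1 => x [/andP[]].
have supE : has_sup E by split => //; exists 0.
set t0 := sup E.
have t00 : 0 <= t0 by apply: (ub_le_sup Eb).
have t0t1 : t0 <= t1 by apply: ge_sup => // [|x [/andP[]]//]; exists 0.
have t0b : 0 <= t0 <= b by rewrite t00 (le_trans t0t1).
have Dt0 : D t0 <= 0.
  rewrite leNgt; apply/negP => Dt0.
  have [d d0 Hd] := cD t0 t0b _ Dt0.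
  have [x [/andP[x0 xt1] Dx] xt0] := sup_adherent d0 supE.
  have xt0' : x <= t0 by apply: (ub_le_sup Eb); split => //; rewrite x0.
  have : `|D x - D t0| < D t0.
    apply: Hd; first by rewrite x0 (le_trans xt1).
    by rewrite ler0_norm ?subr_le0//; move: xt0; rewrite -/t0; lra.
  by rewrite ltr_norml => /andP[+ _]; lra.
have {t0t1}t0t1 : t0 < t1.
  by rewrite lt_neqAle t0t1 andbT; apply/eqP => tt; move: Dt1; rewrite -tt ltNge Dt0.
have Dpos t : t0 < t -> t <= t1 -> 0 < D t.
  move=> t0t tt1; rewrite ltNge; apply/negP => Dt.
  have : t <= t0 by apply: (ub_le_sup Eb); split => //; rewrite tt1 andbT (le_trans t00)// ltW.
  by rewrite leNgt t0t.
have [d d0 Hd] := cD t0 t0b _ k0.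
pose m := Num.min (d / 2) ((t1 - t0) / 2).
have m0 : 0 < m by rewrite lt_min; apply/andP; split; lra.
have [md mt] : m <= d / 2 /\ m <= (t1 - t0) / 2.
  by split; rewrite ge_min lexx ?orbT.
pose t2 := t0 + m.
have t2t1 : t2 < t1 by rewrite /t2; lra.
have t02 : t0 < t2 by rewrite /t2; lra.
have Dt2 : 0 < D t2 by apply: Dpos => //; exact: ltW.
have [d' d'0 Hd'] := cD t0 t0b _ Dt2.
pose u := t0 + Num.min (d' / 2) (m / 2).
have um0 : 0 < Num.min (d' / 2) (m / 2) by rewrite lt_min; apply/andP; split; lra.
have [ud um] : Num.min (d' / 2) (m / 2) <= d' / 2 /\ Num.min (d' / 2) (m / 2) <= m / 2.
  by split; rewrite ge_min lexx ?orbT.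
(* [u] is so close to [t0] that [D u < D t2], against monotonicity on
   [u, t2]. *)
have t0u : t0 < u by rewrite /u; lra.
have ut2 : u <= t2 by rewrite /u /t2; lra.
have Du : D u < D t2.
  have : `|D u - D t0| < D t2.
    apply: Hd'; first by apply/andP; split; lra.
    by rewrite ger0_norm /u; lra.
  by move=> /ltr_normlW; lra.
suff : D t2 <= D u by lra.
apply: absolutely_continuous_nonincreasing => //.
  by apply: acD => //; lra.
move: aeD; apply: ae_impl => t Ht; rewrite in_itv/= => /andP[ut tt2].
have [|d1 dD dk] := Ht; first by rewrite in_itv/=; apply/andP; split; lra.
exists d1 => //; apply: dk; rewrite Dpos/=; [|lra|lra].
have : `|D t - D t0| < k.
  apply: Hd; first by apply/andP; split; lra.
  by rewrite ger0_norm; move: tt2; rewrite /t2; lra.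
by move=> /ltr_normlW; lra.
Qed.

(** * Operations on absolutely continuous functions, and primitives *)

Lemma absolutely_continuousS (R : realType) (a b a' b' : R) (F : R -> R) :
  a <= a' -> b' <= b -> absolutely_continuous a b F ->
  absolutely_continuous a' b' F.
Proof.
move=> aa bb acF e e0; have [d d0 Hd] := acF e e0; exists d => // n u v uv tI uvd.
apply: Hd => // i; have [au ? vb] := uv i.
by split; rewrite ?(le_trans aa)// (le_trans vb).
Qed.

Lemma absolutely_continuous_continuous (R : realType) (a b : R) (F : R -> R) :
  absolutely_continuous a b F -> {within `[a, b], continuous F}.
Proof.
move=> acF; apply/within_continuous_distP => x /andP[ax xb] e e0.
have [d d0 Hd] := acF e e0; exists d => // y /andP[ay yb] xy.
wlog xley : x y ax xb ay yb xy / x <= y => [hw|].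
  have [xley|/ltW yx] := leP x y; first exact: hw.
  by rewrite distrC; apply: hw; rewrite // distrC.
have := Hd 1%N (fun=> x) (fun=> y); rewrite !big_ord1; apply => //.
  by move=> i j _ _ _; rewrite (ord1 i) (ord1 j).
by move: xy; rewrite ger0_norm// subr_ge0.
Qed.

(** Sums, multiples and Lipschitz functions of absolutely continuous functions
    are all instances. *)
Lemma absolutely_continuous_bounded_increments (R : realType) (a b K : R) (F G H : R -> R) :
  absolutely_continuous a b F -> absolutely_continuous a b G ->
  (forall x y, a <= x -> x <= y -> y <= b ->
     `|H y - H x| <= K * (`|F y - F x| + `|G y - G x|)) ->
  absolutely_continuous a b H.
Proof.
move=> acF acG FGH e e0.
pose L := 2 * (`|K| + 1).
have L0 : 0 < L by rewrite mulr_gt0// ltr_wpDl.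
have eL : 0 < e / L by rewrite divr_gt0.
have [d1 d10 H1] := acF _ eL; have [d2 d20 H2] := acG _ eL.
exists (Num.min d1 d2); first by rewrite lt_min d10.
move=> n u v uv tI; rewrite lt_min => /andP[S1 S2].
have {}H1 := H1 n u v uv tI S1; have {}H2 := H2 n u v uv tI S2.
have KL : `|K| <= L / 2 by rewrite /L mulrC mulKf// lerDl.
apply: (@le_lt_trans _ _ (L / 2 * (\sum_(i < n) `|F (v i) - F (u i)| +
     \sum_(i < n) `|G (v i) - G (u i)|))).
  rewrite -big_split mulr_sumr ler_sum//= => i _.
  have [au uv' vb] := uv i; apply: (le_trans (FGH _ _ au uv' vb)).
  rewrite ler_wpM2r ?addr_ge0//; exact: le_trans (ler_norm K) KL.
rewrite -(@ltr_pM2l _ (2 / L)) ?divr_gt0//.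
have -> x : 2 / L * (L / 2 * x) = x by rewrite mulrA mulf_div (mulrC 2) divff ?mul1r ?mulf_neq0 ?gt_eqF.
rewrite -mulrA (mulrC L^-1); move: H1 H2; set s1 := \sum_(i < n) _; set s2 := \sum_(i < n) _.
by clear; lra.
Qed.

Lemma absolutely_continuous_id (R : realType) (a b : R) :
  absolutely_continuous a b (@id R).
Proof.
move=> e e0; exists e => // n u v uv _.
by under eq_bigr => i _ do [have [_ uvi _] := uv i; rewrite -(ger0_norm (x := v i - u i)) ?subr_ge0//].
Qed.

Lemma absolutely_continuous_scale (R : realType) (k a b : R) :
  absolutely_continuous a b (fun t => k * t).
Proof.
apply: (absolutely_continuous_bounded_increments (K := `|k|)
  (@absolutely_continuous_id R a b) (@absolutely_continuous_id R a b)) => x z _ _ _.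
by rewrite -mulrBr normrM ler_wpM2l// lerDl.
Qed.

Lemma within_continuousB (R : realType) (A : set R) (F G : R -> R) :
  {within A, continuous F} -> {within A, continuous G} ->
  {within A, continuous (fun t => F t - G t)}.
Proof. by move=> cF cG x; exact: cvgB (cF x) (cG x). Qed.

Lemma is_derive_sub (R : realType) (F G : R -> R) (t dF dG : R) :
  is_derive t 1 F dF -> is_derive t 1 G dG ->
  is_derive t 1 (fun x => F x - G x) (dF - dG).
Proof. by move=> hF hG; exact: is_deriveB. Qed.

Lemma is_derive_scale (R : realType) (k t : R) : is_derive t 1 (fun x => k * x) k.
Proof.
have := @is_deriveZ R R R id k t 1 1 (is_derive_id t 1).
by rewrite /GRing.scale/= mulr1.
Qed.

Lemma absolutely_continuous_reflect (R : realType) (a b m : R) (F : R -> R) :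
  absolutely_continuous a b F ->
  absolutely_continuous (m - b) (m - a) (fun t => F (m - t)).
Proof.
move=> acF e e0; have [d d0 Hd] := acF e e0; exists d => // n u v uv tI uvd.
under eq_bigr do rewrite distrC.
apply: (Hd n (fun i => m - v i) (fun i => m - u i)).
- by move=> i; have [au uvi vb] := uv i; split; lra.
- move=> i j _ _ [z /=]; rewrite !in_itv/= => -[/andP[z1 z2] /andP[z3 z4]].
  apply: tI => //; exists (m - z); split => /=; rewrite in_itv/=; apply/andP; split; lra.
- by apply: le_lt_trans uvd; apply: ler_sum => i _; lra.
Qed.

(** A nondecreasing 1-Lipschitz change of variable maps disjoint intervals to
    disjoint, not longer ones. *)
Lemma absolutely_continuous_comp_nondecreasing (R : realType) (a b a' b' : R) (F m : R -> R) :
  (forall x y, a <= x -> x <= y -> y <= b ->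
     [/\ a' <= m x, m x <= m y, m y <= b' & m y - m x <= y - x]) ->
  absolutely_continuous a' b' F ->
  absolutely_continuous a b (fun t => F (m t)).
Proof.
move=> mP acF e e0; have [d d0 Hd] := acF e e0; exists d => // n u v uv tI uvd.
apply: (Hd n (fun i => m (u i)) (fun i => m (v i))).
- by move=> i; have [au uvi vb] := uv i; have [] := mP _ _ au uvi vb.
- move=> i j _ _ [z /=]; rewrite !in_itv/= => -[/andP[z1 z2] /andP[z3 z4]].
  have [aui uvi vbi] := uv i; have [auj uvj vbj] := uv j.
  have key (k l : 'I_n) : v k <= u l -> m (u l) < z -> z < m (v k) -> False.
    move=> vu zu zv; have [auk uvk vbk] := uv k; have [aul uvl vbl] := uv l.
    have [] := mP (v k) (u l); rewrite ?(le_trans auk)// ?(le_trans uvl)//.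
    by move=> _; rewrite leNgt (lt_trans zu zv).
  have ne (k : 'I_n) : m (u k) < z -> z < m (v k) -> u k < v k.
    move=> zu zv; rewrite ltNge; apply/negP => vu; have [auk uvk vbk] := uv k.
    have uvE : u k = v k by apply: le_anti; rewrite uvk vu.
    by have := lt_trans zu zv; rewrite uvE ltxx.
  apply: tI => //.
  have [vu|uvij] := leP (v i) (u j); first by case: (key i j).
  have [vu|uvji] := leP (v j) (u i); first by case: (key j i).
  have lt1 := ne i z1 z2; have lt2 := ne j z3 z4.
  pose M := Num.max (u i) (u j); pose N := Num.min (v i) (v j).
  have MN : M < N by rewrite gt_max !lt_min lt1 lt2 uvij uvji.
  have [uM uM'] : u i <= M /\ u j <= M by split; rewrite le_max lexx ?orbT.
  have [vN vN'] : N <= v i /\ N <= v j by split; rewrite ge_min lexx ?orbT.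
  exists ((M + N) / 2); split => /=; rewrite in_itv/=; apply/andP; split; clear -MN uM uM' vN vN'; lra.
- apply: le_lt_trans uvd; apply: ler_sum => i _.
  by have [au uvi vb] := uv i; have [] := mP _ _ au uvi vb.
Qed.

(** The glued function is [F (min t c) + G (max t c) - G c], which spares
    splitting the intervals that contain [c]. *)
Lemma absolutely_continuous_glue (R : realType) (a b c : R) (F G : R -> R) :
  a <= c -> c <= b -> F c = G c ->
  absolutely_continuous a c F -> absolutely_continuous c b G ->
  absolutely_continuous a b (fun t => if t <= c then F t else G t).
Proof.
move=> ac cb FG acF acG.
have acF' : absolutely_continuous a b (fun t => F (Num.min t c)).
  apply: (@absolutely_continuous_comp_nondecreasing _ _ _ a c F) => // x y ax xy yb.
  have [xc|cx] := leP x c; have [yc|cy] := leP y c; split => //; lra.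
have acG' : absolutely_continuous a b (fun t => G (Num.max t c)).
  apply: (@absolutely_continuous_comp_nondecreasing _ _ _ c b G) => // x y ax xy yb.
  have [xc|cx] := leP x c; have [yc|cy] := leP y c; split => //; lra.
apply: (absolutely_continuous_bounded_increments (K := 1) acF' acG') => x y ax xy yb.
rewrite mul1r; apply: le_trans (ler_normD _ _).
have [xc|cx] := leP x c; have [yc|cy] := leP y c; rewrite le_eqVlt; apply/orP; left;
  apply/eqP; congr `|_|.
- by rewrite subrr addr0.
- by rewrite FG; ring.
- by lra.
- by rewrite subrr add0r.
Qed.

(** Integrating from minus infinity lets all functions live on the whole line;
    they are extended by zero outside the interval of interest. *)
Definition primitive (R : realType) (r : R -> R) (t : R) : R :=
  \int[@lebesgue_measure R]_(x in `]-oo, t]) r x.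

Notation integrableR r := ((@lebesgue_measure _).-integrable setT (EFin \o r)).

Lemma integrableR_itv (R : realType) (r : R -> R) (i : interval R) :
  integrableR r -> (@lebesgue_measure R).-integrable [set` i] (EFin \o r).
Proof. by move=> ir; apply: integrableS ir. Qed.

Lemma primitiveB (R : realType) (r : R -> R) (u v : R) : integrableR r -> u <= v ->
  primitive r v - primitive r u = \int[@lebesgue_measure R]_(x in `]u, v]) r x.
Proof.
move=> ir uv; rewrite /primitive Rintegral_itvB//; exact: integrableR_itv.
Qed.

Lemma integrableR_norm (R : realType) (r : R -> R) :
  integrableR r -> integrableR (fun t => `|r t|).
Proof. by move=> ir; apply: (integrable_abse ir). Qed.

Lemma primitive_norm_increment (R : realType) (r : R -> R) (u v : R) :
  integrableR r -> u <= v ->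
  `|primitive r v - primitive r u| <= \int[@lebesgue_measure R]_(x in `]u, v]) `|r x|.
Proof.
move=> ir uv; rewrite primitiveB//; apply: le_normr_Rintegral => //.
exact: integrableR_itv.
Qed.

Lemma primitive_absolutely_continuous (R : realType) (r : R -> R) (a b : R) :
  integrableR r -> absolutely_continuous a b (primitive r).
Proof.
move=> ir e e0; have [d [d0 Hd]] := integral_normr_continuous ir e0.
exists d => // n u v uv tI uvd.
pose F (i : 'I_n) := [set` `]u i, v i[].
pose D := \big[setU/set0]_(i < n) F i.
have mF i : measurable (F i) by exact: measurable_itv.
have mD : measurable D by apply: bigsetU_measurable.
have irn := integrableR_norm ir.
have DE : (\sum_(i < n) \int[@lebesgue_measure R]_(x in `]u i, v i[) `|r x|)%R
    = \int[@lebesgue_measure R]_(x in D) `|r x|.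
  apply: EFin_inj; rewrite /Rintegral fineK; last first.
    by apply: integrable_fin_num => //; apply: integrableS irn.
  rewrite /D ge0_integral_bigsetU//.
  - rewrite -sumEFin; apply: eq_bigr => i _; rewrite fineK//.
    by apply: integrable_fin_num => //; exact: (integrableR_itv _ irn).
  - exact: index_enum_uniq.
  - exact: sub_trivIset tI.
  - by apply: measurable_funTS; exact: (measurable_int _ irn).
apply: (@le_lt_trans _ _ (\int[@lebesgue_measure R]_(x in D) `|r x|)).
  rewrite -DE; apply: ler_sum => i _; have [_ uvi _] := uv i.
  rewrite Rintegral_itv_bndo_bndc ?primitive_norm_increment//.
  exact: (integrableR_itv _ irn).
apply: Hd => //; apply: le_lt_trans (_ : ((\sum_(i < n) (v i - u i))%:E < d%:E)%E); last first.
  by rewrite lte_fin.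
rewrite /D measure_bigsetU_ord_cond//=; [|by move=> i _; exact: mF|exact: sub_trivIset tI].
rewrite -sumEFin; apply: lee_sum => i _; have [_ uvi _] := uv i.
rewrite lebesgue_measure_itv/= lte_fin; case: ifPn => // _.
by rewrite lee_fin subr_ge0.
Qed.

Lemma primitive_is_derive (R : realType) (r : R -> R) : integrableR r ->
  {ae (@lebesgue_measure R), forall t : R, is_derive t 1 (primitive r) (r t)}.
Proof.
move=> ir.
have H : {ae (@lebesgue_measure R), forall t : R,
    derivable (primitive r) t 1 /\ derive1 (primitive r) t = r t}.
  apply: FTC1Ny; first by move=> t; exact: integrableR_itv.
  by apply: open_integrable_locally => //; exact: openT.
apply: ae_impl H => t [dt dE]; apply: DeriveDef; first exact: dt.
by rewrite -derive1E.
Qed.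

Lemma primitive_cvg (R : realType) (r_ : nat -> R -> R) (r g : R -> R) (t : R) :
  (forall n, integrableR (r_ n)) -> integrableR g ->
  (forall n x, `|r_ n x| <= g x) ->
  (forall x, r_ n x @[n --> \oo] --> r x) ->
  integrableR r /\ primitive (r_ n) t @[n --> \oo] --> primitive r t.
Proof.
move=> ir ig rg rr.
have mr : measurable_fun setT r.
  apply: (@measurable_fun_cvg _ _ _ setT r_) => // n.
  by apply/measurable_EFinP; exact: (measurable_int _ (ir n)).
have irr : integrableR r.
  apply: (le_integrable _ _ _ ig) => //; first exact/measurable_EFinP.
  move=> x _ /=; rewrite lee_fin.
  apply: (@le_trans _ _ (g x)); last exact: ler_norm.
  rewrite -(cvg_lim _ (cvg_norm (rr x)))//.
  apply: limr_le; first by apply: is_cvg_norm; apply/cvg_ex; exists (r x).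
  by apply: nearW => n; exact: rg.
split => //.
have [//||||||_ _ C] := @dominated_convergence _ _ R (@lebesgue_measure R) `]-oo, t]%classic _
  (fun n x => (r_ n x)%:E) (fun x => (r x)%:E) (fun x => (g x)%:E).
- by move=> n; apply: measurable_funTS; exact: (measurable_int _ (ir n)).
- by apply: measurable_funTS; exact/measurable_EFinP.
- by apply: aeW => x _; apply: cvg_EFin; [exact: nearW|exact: rr].
- exact: integrableR_itv.
- by apply: aeW => x n _; rewrite /= lee_fin; exact: rg.
- rewrite /primitive /Rintegral; apply: fine_cvg; move: C; rewrite fineK//.
  by apply: integrable_fin_num => //; exact: integrableR_itv.
Qed.

(** * Picard iteration *)

Lemma primitive_continuous (R : realType) (r : R -> R) : integrableR r ->
  continuous (primitive r).
Proof.
move=> ir x; have := absolutely_continuous_continuous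
  (primitive_absolutely_continuous (x - 1) (x + 1) ir).
move=> /within_continuous_distP cF; apply/cvgrPdist_lt => e e0.
have [|d d0 Hd] := cF x _ e e0; first by apply/andP; split; lra.
apply/nbhs_ballP; exists (Num.min d 1) => /=; first by rewrite lt_min d0 ltr01.
move=> y; rewrite /ball/= lt_min => /andP[xyd]; rewrite ltr_distl => /andP[y1 y2].
rewrite distrC; apply: Hd; [by apply/andP; split; lra|by rewrite distrC].
Qed.

Lemma primitive_measurable (R : realType) (r : R -> R) : integrableR r ->
  measurable_fun setT (primitive r).
Proof. by move=> ir; apply: continuous_measurable_fun; exact: primitive_continuous. Qed.

Lemma primitive_bounded (R : realType) (r : R -> R) : integrableR r ->
  forall t, `|primitive r t| <= \int[@lebesgue_measure R]_x `|r x|.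
Proof.
move=> ir t; have irn := integrableR_norm ir.
apply: (le_trans (le_normr_Rintegral _ (integrableR_itv _ ir))) => //.
rewrite /Rintegral fine_le//.
- by apply: integrable_fin_num => //; exact: (integrableR_itv _ irn).
- by apply: integrable_fin_num.
- apply: ge0_subset_integral => //; exact: (measurable_int _ irn).
Qed.

Lemma primitive_support (R : realType) (r : R -> R) (b t : R) :
  (forall x, x \notin `]0, b[ -> r x = 0) -> t <= 0 -> primitive r t = 0.
Proof.
move=> r0 t0; rewrite /primitive (@eq_Rintegral _ _ _ _ _ (fun=> 0)).
  by rewrite /Rintegral integral0.
move=> x; rewrite inE/= in_itv/= => xt; apply: r0.
by rewrite in_itv/= negb_and -leNgt (le_trans xt).
Qed.

Lemma absolutely_continuousB (R : realType) (a b : R) (F G : R -> R) :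
  absolutely_continuous a b F -> absolutely_continuous a b G ->
  absolutely_continuous a b (fun t => F t - G t).
Proof.
move=> acF acG.
apply: (absolutely_continuous_bounded_increments (K := 1) acF acG) => x y _ _ _.
rewrite mul1r; have -> : F y - G y - (F x - G x) = (F y - F x) - (G y - G x) by ring.
exact: ler_normB.
Qed.

Lemma expR_absolutely_continuous (R : realType) (k a b : R) : 0 <= k ->
  absolutely_continuous a b (fun t => expR (k * t)).
Proof.
move=> k0.
apply: (absolutely_continuous_bounded_increments (K := k * expR (k * b))
  (absolutely_continuous_id a b) (absolutely_continuous_id a b)) => x y ax xy yb.
have kxy : k * x <= k * y by rewrite ler_wpM2l.
rewrite ger0_norm ?subr_ge0 ?ler_expR// ger0_norm ?subr_ge0//.
have -> : expR (k * y) - expR (k * x) = expR (k * y) * (1 - expR (k * x - k * y)).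
  by rewrite mulrBr mulr1 -expRD addrCA subrr addr0.
have h1 : 1 - expR (k * x - k * y) <= k * (y - x).
  by have := expR_ge1Dx (k * x - k * y); lra.
have h0 : 0 <= 1 - expR (k * x - k * y) by rewrite subr_ge0 -expR0 ler_expR subr_le0.
apply: (@le_trans _ _ (expR (k * b) * (k * (y - x)))).
  by apply: ler_pM => //; rewrite ?expR_ge0// ler_expR ler_wpM2l.
rewrite mulrA [expR _ * k]mulrC ler_wpM2l ?mulr_ge0 ?expR_ge0//.
by rewrite lerDl subr_ge0.
Qed.

Lemma is_derive_expRM (R : realType) (k t : R) :
  is_derive t 1 (fun x => expR (k * x)) (k * expR (k * t)).
Proof.
have dk : is_derive t 1 (fun x : R => k * x) k.
  have := @is_deriveZ R R R id k t 1 1 (is_derive_id t 1).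
  by rewrite /GRing.scale/= mulr1.
by have := @is_derive1_comp R expR (fun x => k * x) t _ _ (is_derive_expR (k * t)) dk; rewrite mulrC.
Qed.

(** The integral estimate behind Picard iteration: in the norm weighted by
    [expR (k * t)], integration gains a factor [k]. *)
Lemma primitive_expR_le (R : realType) (b c k : R) (r : R -> R) :
  0 <= c -> 0 <= k -> integrableR r -> (forall x, x \notin `]0, b[ -> r x = 0) ->
  (forall x, x \in `]0, b[ -> r x <= c * (k * expR (k * x))) ->
  forall t, primitive r t <= c * expR (k * t).
Proof.
move=> c0 k0 ir r0 rk t.
have [t0|t0] := leP t 0; first by rewrite (primitive_support r0)// mulr_ge0// expR_ge0.
have rk' x : r x <= c * (k * expR (k * x)).
  have [/rk//|/r0->] := boolP (x \in `]0, b[).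
  by rewrite !mulr_ge0 ?expR_ge0.
suff : primitive r t - c * expR (k * t) <= primitive r 0 - c * expR (k * 0).
  by rewrite (primitive_support r0 (lexx _)) mulr0 expR0; lra.
apply: (absolutely_continuous_nonincreasing
    (F := fun t => primitive r t - c * expR (k * t)) (ltW t0)).
  apply: absolutely_continuousB; first exact: primitive_absolutely_continuous.
  apply: (absolutely_continuous_bounded_increments (K := c)
    (expR_absolutely_continuous 0 t k0) (expR_absolutely_continuous 0 t k0)).
  move=> x y _ _ _; rewrite -mulrBr normrM ger0_norm// ler_wpM2l//.
  by rewrite lerDl.
apply: ae_impl (primitive_is_derive ir) => x dr _.
exists (r x - c * (k * expR (k * x))); last by rewrite subr_le0.
by apply: is_deriveB => //; apply: is_deriveZ; exact: is_derive_expRM.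
Qed.

Lemma cvg_geometric_increments (R : realType) (c : R) (u : nat -> R) :
  (forall k, `|u k.+1 - u k| <= c * 2^-1 ^+ k) -> cvgn u.
Proof.
move=> uc.
have c0 : 0 <= c by have := uc 0%N; rewrite expr0 mulr1; exact: le_trans.
pose v := [sequence u k.+1 - u k]_k.
have cv : cvgn (series v).
  apply: normed_cvg; apply: (@series_le_cvg _ _ (geometric c 2^-1)).
  - by move=> n; rewrite /=.
  - by move=> n; rewrite /= /geometric mulr_ge0// exprn_ge0.
  - by move=> n; exact: uc.
  - by apply: is_cvg_geometric_series; rewrite ger0_norm// invf_lt1// ltr1n.
have -> : u = (fun n => series v n + u 0%N).
  by apply/funext => n; rewrite /series/= telescope_sumr// subrK.
by apply: is_cvgD => //; exact: is_cvg_cst.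
Qed.

Lemma bound_geometric_increments (R : realType) (c : R) (u : nat -> R) :
  (forall k, `|u k.+1 - u k| <= c * 2^-1 ^+ k) ->
  forall n, `|u n - u 0%N| <= 2 * c.
Proof.
move=> uc.
have c0 : 0 <= c by have := uc 0%N; rewrite expr0 mulr1; exact: le_trans.
have H n : `|u n - u 0%N| <= 2 * c * (1 - 2^-1 ^+ n).
  elim: n => [|n IH]; first by rewrite subrr normr0 expr0 subrr mulr0.
  have := uc n; have := ler_distD (u n) (u n.+1) (u 0%N); rewrite exprS.
  by move: IH; set q := _ ^+ n; lra.
move=> n; apply: (le_trans (H n)); rewrite ler_piMr ?mulr_ge0//.
Qed.

Lemma integrableR_add (R : realType) (f g : R -> R) :
  integrableR f -> integrableR g -> integrableR (fun t => f t + g t).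
Proof. by move=> i j; apply: eq_integrable (integrableD measurableT i j). Qed.

Lemma integrableR_scale (R : realType) (k : R) (f : R -> R) :
  integrableR f -> integrableR (fun t => k * f t).
Proof. by move=> i; apply: eq_integrable (integrableZl measurableT k i). Qed.

Lemma integrableR_sub (R : realType) (f g : R -> R) :
  integrableR f -> integrableR g -> integrableR (fun t => f t - g t).
Proof. by move=> i j; apply: eq_integrable (integrableB measurableT i j). Qed.

Lemma integrableR_affine (R : realType) (a r v : R -> R) (K : R) :
  integrableR a -> integrableR r -> measurable_fun setT v ->
  (forall t, `|v t| <= K) -> integrableR (fun t => a t * v t + r t).
Proof.
move=> ia ir mv vK; apply: integrableR_add => //.
have : integrableR (fun t => v t * a t).
  apply: (@integrableMr _ _ _ (@lebesgue_measure R) setT _ v (EFin \o a)) => //.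
  by exists K; split; [exact: num_real|move=> M KM t _; exact: le_trans (vK t) (ltW KM)].
by apply: eq_integrable => // t _ /=; rewrite mulrC.
Qed.

Lemma lipschitz_continuous (R : realType) (g : R -> R) (L : R) :
  (forall x y, `|g x - g y| <= L * `|x - y|) -> continuous g.
Proof.
move=> gL x; apply/cvgrPdist_lt => e e0.
have L0 : 0 < `|L| + 1 by rewrite ltr_wpDl.
apply/nbhs_ballP; exists (e / (`|L| + 1)) => /=; first by rewrite divr_gt0.
move=> y; rewrite /ball/= ltr_pdivlMr// => xy.
apply: le_lt_trans (gL _ _) _; apply: le_lt_trans xy.
by rewrite mulrC ler_wpM2l// (le_trans (ler_norm _))// lerDl.
Qed.

Section picard.
Variables (R : realType) (b A L : R) (a r g : R -> R).
Hypotheses (L0 : 0 < L) (A0 : 0 < A).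
Hypothesis a_int : integrableR a.
Hypothesis r_int : integrableR r.
Hypothesis a_bnd : forall t, `|a t| <= A.
Hypothesis a_supp : forall t, t \notin `]0, b[ -> a t = 0.
Hypothesis r_supp : forall t, t \notin `]0, b[ -> r t = 0.
Hypothesis g_lip : forall x y, `|g x - g y| <= L * `|x - y|.

Let rhs (u : R -> R) (t : R) := a t * g (u t) + r t.

(** The iterates differ by [M * expR (K * t) / 2 ^ k]: the weight with
    [K = 2 * (A * L)] turns the integral operator into a contraction of ratio
    1/2 on an interval of any length. *)
Fixpoint picard_iter (k : nat) : R -> R :=
  if k is n.+1 then primitive (rhs (picard_iter n)) else fun=> 0.

Let admissible (u : R -> R) := measurable_fun setT u /\ exists C, forall t, `|u t| <= C.

Let rhs_int u : admissible u -> integrableR (rhs u).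
Proof.
move=> [mu [C uC]]; apply: (integrableR_affine (K := `|g 0| + L * C)) => //.
  apply: (measurableT_comp _ mu); apply: continuous_measurable_fun.
  exact: lipschitz_continuous g_lip.
move=> t; have := ler_normD (g (u t) - g 0) (g 0); rewrite subrK => /le_trans; apply.
rewrite addrC lerD2l (le_trans (g_lip _ _))// subr0 ler_wpM2l//; exact: ltW.
Qed.

Let picard_admissible k : admissible (picard_iter k).
Proof.
elim: k => [|k IH].
  by split; [exact: measurable_cst|exists 0 => t; rewrite normr0].
have ir := rhs_int IH; split; first exact: primitive_measurable.
by exists (\int[@lebesgue_measure R]_x `|rhs (picard_iter k) x|) => t; exact: primitive_bounded.
Qed.

Let picard_int k := rhs_int (picard_admissible k).

Let rhs_supp u t : t \notin `]0, b[ -> rhs u t = 0.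
Proof. by move=> tb; rewrite /rhs a_supp// r_supp// mul0r addr0. Qed.

Let M := \int[@lebesgue_measure R]_x `|rhs (picard_iter 0) x|.

Let M0 : 0 <= M.
Proof. exact: Rintegral_ge0. Qed.

Let K := 2 * (A * L).

Let K0 : 0 < K.
Proof. by rewrite !mulr_gt0. Qed.

Let picard_increment k : forall t,
  `|picard_iter k.+1 t - picard_iter k t| <= M * expR (K * t) * 2^-1 ^+ k.
Proof.
elim: k => [|k IH] t.
  rewrite /= subr0 expr0 mulr1; have [t0|t0] := leP t 0.
    rewrite (@primitive_support _ _ b)// ?normr0 ?mulr_ge0 ?expR_ge0//.
    by move=> x; exact: rhs_supp.
  apply: (le_trans (primitive_bounded (picard_int 0) t)).
  by rewrite ler_peMr// -expR0 ler_expR mulr_ge0// ltW.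
have i1 := picard_int k.+1; have i0 := picard_int k.
have id : integrableR (fun x => rhs (picard_iter k.+1) x - rhs (picard_iter k) x).
  exact: integrableR_sub.
have -> : picard_iter k.+2 t - picard_iter k.+1 t =
   primitive (fun x => rhs (picard_iter k.+1) x - rhs (picard_iter k) x) t.
  by rewrite /primitive RintegralB//; exact: integrableR_itv.
apply: le_trans (_ : _ <= primitive (fun x => `|rhs (picard_iter k.+1) x - rhs (picard_iter k) x|) t) _.
  by apply: le_normr_Rintegral => //; exact: (integrableR_itv _ id).
rewrite [leRHS](_ : _ = M * 2^-1 ^+ k.+1 * expR (K * t)); last by rewrite mulrAC.
apply: (@primitive_expR_le _ b) => //; first by rewrite mulr_ge0// exprn_ge0.
- exact: ltW.
- exact: integrableR_norm.
- by move=> x xb; rewrite !rhs_supp// subrr normr0.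
move=> x xb; rewrite /rhs opprD addrACA subrr addr0 -mulrBr normrM.
apply: (@le_trans _ _ (A * (L * (M * expR (K * x) * 2^-1 ^+ k)))).
  apply: ler_pM => //; apply: (le_trans (g_lip _ _)).
  by rewrite ler_wpM2l// ltW.
rewrite /K exprS; set q := _ ^+ k; set e := expR _.
by rewrite le_eqVlt; apply/orP; left; apply/eqP; field.
Qed.

(** Existence for the Lipschitz equation [y' = a g(y) + r], in integral form
    with [y = 0] on the left of [0, b]. *)
Theorem picard : exists y : R -> R,
  integrableR (fun t => a t * g (y t) + r t) /\
  forall t, y t = primitive (fun t => a t * g (y t) + r t) t.
Proof.
have cvgy t : cvgn (picard_iter ^~ t).
  exact: (@cvg_geometric_increments R (M * expR (K * t))).
pose y t := limn (picard_iter ^~ t).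
pose C := `|g 0| + L * (2 * (M * expR (K * b))).
have cg := lipschitz_continuous g_lip.
have ig : integrableR (fun t => C * `|a t| + `|r t|).
  apply: integrableR_add; last exact: integrableR_norm.
  by apply: integrableR_scale; exact: integrableR_norm.
have key t : integrableR (rhs y) /\
    primitive (rhs (picard_iter n)) t @[n --> \oo] --> primitive (rhs y) t.
  apply: (primitive_cvg (g := fun t => C * `|a t| + `|r t|)) => //.
    move=> n x; apply: (le_trans (ler_normD _ _)); rewrite lerD2r normrM mulrC.
    have [xb|xb] := boolP (x \in `]0, b[); last by rewrite a_supp// normr0 !mulr0.
    apply: ler_wpM2r => //.
    have := ler_normD (g (picard_iter n x) - g 0) (g 0); rewrite subrK => /le_trans; apply.
    rewrite addrC lerD2l (le_trans (g_lip _ _))// subr0 ler_wpM2l//; first exact: ltW.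
    have := @bound_geometric_increments R (M * expR (K * x)) _ (fun k => picard_increment k x) n.
    rewrite /= subr0 => /le_trans; apply; rewrite ler_wpM2l// ler_wpM2l// ler_expR.
    by rewrite ler_wpM2l ?(ltW K0)// ltW// (itvP xb).
  move=> x; apply: cvgD; last exact: cvg_cst.
  apply: cvgMr; apply: continuous_cvg; [exact: cg|exact: cvgy].
exists y; split; first exact: (key 0).1.
move=> t; have [_ kt] := key t.
have : picard_iter n.+1 t @[n --> \oo] --> y t.
  by rewrite (cvg_shiftS (picard_iter ^~ t)); exact: cvgy.
by move=> /cvg_unique; apply => //; exact: kt.
Qed.
End picard.

(** * Powers with exponent below one, and the sublinear equation *)

Lemma max_contraction (R : realType) (x y e : R) :
  `|Num.max x e - Num.max y e| <= `|x - y|.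
Proof.
have h1 := ler_norm (x - y); have := ler_norm (y - x); rewrite distrC => h2.
rewrite ler_norml; have [xe|xe] := leP x e; have [ye|ye] := leP y e;
  apply/andP; split; lra.
Qed.

Lemma max_contraction2 (R : realType) (x y e f : R) :
  `|Num.max x e - Num.max y f| <= `|x - y| + `|e - f|.
Proof.
have -> : Num.max x e - Num.max y f =
    (Num.max x e - Num.max y e) + (Num.max e y - Num.max f y).
  by rewrite (maxC e) (maxC f) subrKA.
by apply: (le_trans (ler_normD _ _)); rewrite lerD// max_contraction.
Qed.

Section powR_facts.
Variables (R : realType) (al : R).
Hypotheses (al0 : 0 < al) (al1 : al < 1).

(** By concavity, the slope of the chord from the origin decreases. *)
Lemma powR_ratio (m y : R) : 0 < m -> m <= y -> y `^ al <= m `^ al / m * y.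
Proof.
move=> m0 my.
have ym : 1 <= y / m by rewrite ler_pdivlMr// mul1r.
have := ler1_powR ym (ltW al1) => h.
have -> : y = y / m * m by rewrite divfK// gt_eqF.
rewrite powRM ?(ltW m0)// ?divr_ge0 ?(ltW m0)// ?(le_trans (ltW m0))//.
rewrite mulrC mulrA -[X in _ <= X]mulrA (mulrC _ m) mulrA divfK ?gt_eqF//.
by rewrite ler_wpM2l// powR_ge0.
Qed.

(** Powers with exponent below one are Lipschitz away from zero. *)
Lemma powR_lipschitz (m x y : R) : 0 < m -> m <= x -> m <= y ->
  `|x `^ al - y `^ al| <= m `^ al / m * `|x - y|.
Proof.
move=> m0; wlog xy : x y / y <= x => [hw mx my|mx my].
  have [yx|/ltW xy] := leP y x; first exact: hw.
  by rewrite distrC (distrC x); exact: hw.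
have y0 : 0 < y by exact: lt_le_trans my.
rewrite !ger0_norm ?subr_ge0//; last by rewrite ge0_ler_powR ?nnegrE ?(ltW al0)// ltW// (lt_le_trans y0).
have h := powR_ratio y0 xy.
apply: (@le_trans _ _ (y `^ al / y * (x - y))).
  by rewrite mulrBr divfK ?gt_eqF// lerB.
rewrite ler_wpM2r ?subr_ge0// ler_pdivrMr//; exact: powR_ratio.
Qed.

Lemma powR_subadditive (y z : R) : 0 <= y -> 0 <= z -> (y + z) `^ al <= y `^ al + z `^ al.
Proof.
move=> y0 z0; have [s0|s0] := leP (y + z) 0.
  have yz0 : y + z = 0 by apply: le_anti; rewrite s0 addr_ge0.
  by rewrite yz0 powR0 ?gt_eqF// addr_ge0// powR_ge0.
have key u : 0 <= u -> u <= y + z -> u / (y + z) * (y + z) `^ al <= u `^ al.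
  rewrite le_eqVlt => /predU1P[<- _|u0 us]; first by rewrite !mul0r powR_ge0.
  have us1 : 0 < u / (y + z) <= 1 by rewrite divr_gt0//= ler_pdivrMr// mul1r.
  have := ger1_powR us1 (ltW al1) => h.
  rewrite [u in leRHS](_ : u = u / (y + z) * (y + z)); last by rewrite divfK// gt_eqF.
  by rewrite powRM ?divr_ge0 ?(ltW u0) ?(ltW s0)// ler_wpM2r// powR_ge0.
apply: le_trans (lerD (key y y0 _) (key z z0 _)); rewrite ?lerDl ?lerDr//.
by rewrite -mulrDl -mulrDl divff ?mul1r// gt_eqF.
Qed.

(** Up to zero the power is only Holder continuous. *)
Lemma powR_holder (x y : R) : 0 <= x -> 0 <= y ->
  `|x `^ al - y `^ al| <= `|x - y| `^ al.
Proof.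
wlog xy : x y / y <= x => [hw x0 y0|x0 y0].
  have [yx|/ltW xy] := leP y x; first exact: hw.
  by rewrite distrC (distrC x); exact: hw.
rewrite !ger0_norm ?subr_ge0//; last by rewrite ge0_ler_powR ?nnegrE// ltW.
by rewrite lerBlDr -{1}(subrK y x) powR_subadditive// subr_ge0.
Qed.

Lemma powR_max_continuous : continuous (fun x : R => Num.max x 0 `^ al).
Proof.
move=> x; apply/cvgrPdist_lt => e e0.
apply/nbhs_ballP; exists (e `^ al^-1) => /=; first by rewrite powR_gt0.
move=> y; rewrite /ball/= => xy.
have mx z : 0 <= Num.max z 0 :> R by rewrite le_max lexx orbT.
apply: le_lt_trans (powR_holder (mx x) (mx y)) _.
apply: (@le_lt_trans _ _ (`|x - y| `^ al)).
  by rewrite ge0_ler_powR ?nnegrE ?(ltW al0)// max_contraction.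
rewrite [ltRHS](_ : e = (e `^ al^-1) `^ al); last by rewrite -powRrM mulVf ?gt_eqF// powRr1// ltW.
by rewrite gt0_ltr_powR ?nnegrE// powR_ge0.
Qed.

Lemma powR_max_cvg (v : nat -> R) (l : R) : v n @[n --> \oo] --> l ->
  Num.max (v n) 0 `^ al @[n --> \oo] --> Num.max l 0 `^ al.
Proof. by move=> vl; exact: (cvg_comp _ _ vl (@powR_max_continuous l)). Qed.

Lemma powR_trunc_lipschitz (e x y : R) : 0 < e ->
  `|Num.max x e `^ al - Num.max y e `^ al| <= e `^ al / e * `|x - y|.
Proof.
move=> e0; apply: (le_trans (powR_lipschitz e0 _ _)); rewrite ?le_max ?lexx ?orbT//.
by rewrite ler_wpM2l ?max_contraction// divr_ge0 ?powR_ge0 ?(ltW e0).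
Qed.

(** Lowering the truncation level lowers the truncated power by at most what it
    lowers it at zero. *)
Lemma powR_trunc_monotone (e e' y : R) : 0 < e' -> e' <= e ->
  0 <= Num.max y e `^ al - Num.max y e' `^ al <= e `^ al - e' `^ al.
Proof.
move=> e'0 ee.
have mono u v : 0 <= u -> u <= v -> u `^ al <= v `^ al.
  by move=> u0 uv; rewrite ge0_ler_powR ?nnegrE ?(ltW al0)// (le_trans u0).
have h1 := mono e' e (ltW e'0) ee.
have [ye|ye] := leP y e; have [ye'|ye'] := leP y e'.
- by rewrite subr_ge0 h1 lexx.
- have y0 : 0 <= y by rewrite ltW// (lt_trans e'0).
  by rewrite subr_ge0 lerB// ?mono// ltW.
- by have := lt_le_trans ye (le_trans ye' ee); rewrite ltxx.
- by rewrite subrr lexx subr_ge0.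
Qed.
(** Lowering the level from [e] to [e'] lowers the corrected right-hand side,
    even if the unknown is slightly larger.  The truncated power may move the
    wrong way by [|a| * (e ^ al - e' ^ al)]; the correction [(A + 1) * e ^ al]
    outweighs this with [e ^ al - e' ^ al] to spare, and the spare part absorbs
    the Lipschitz error due to [y' - y]. *)
Lemma trunc_rhs_decreasing (A a r e e' y y' : R) :
  `|a| <= A -> 0 < e' -> e' <= e -> 0 < y' - y ->
  (y' - y) * (A * (e' `^ al / e')) < e `^ al - e' `^ al ->
  a * Num.max y' e' `^ al + (r + (A + 1) * e' `^ al) -
  (a * Num.max y e `^ al + (r + (A + 1) * e `^ al)) <= 0.
Proof.
move=> aA e'0 ee yy small.
have lip := powR_trunc_lipschitz y' y e'0.
have /andP[mon1 mon2] := powR_trunc_monotone y e'0 ee.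
rewrite (gtr0_norm yy) in lip.
move: lip mon1 mon2 small; set L := e' `^ al / e'.
set p1 := Num.max y' e' `^ al; set p2 := Num.max y e' `^ al.
set p3 := Num.max y e `^ al; set q := e `^ al; set q' := e' `^ al => lip mon1 mon2 small.
have e1 : a * (p1 - p2) <= q - q'.
  apply: le_trans (ltW small); apply: (le_trans (ler_norm _)); rewrite normrM.
  by rewrite mulrCA (mulrC (y' - y)); apply: ler_pM.
have e2 : a * (p2 - p3) <= A * (q - q').
  apply: (le_trans (ler_norm _)); rewrite normrM; apply: ler_pM => //.
  by rewrite distrC ger0_norm.
by move: e1 e2; rewrite !mulrDl !mul1r !mulrBr; lra.
Qed.
End powR_facts.

Section existence.
Variables (R : realType) (b al A : R) (a r : R -> R).
Hypotheses (al0 : 0 < al) (al1 : al < 1) (A0 : 0 < A).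
Hypothesis a_int : integrableR a.
Hypothesis r_int : integrableR r.
Hypothesis a_bnd : forall t, `|a t| <= A.
Hypothesis a_supp : forall t, t \notin `]0, b[ -> a t = 0.
Hypothesis r_supp : forall t, t \notin `]0, b[ -> r t = 0.
Hypothesis r_ge0 : forall t, 0 <= r t.

Let ep (n : nat) : R := 2^-1 ^+ n.

Let ep_gt0 n : 0 < ep n. Proof. by rewrite exprn_gt0. Qed.

Let epS n : ep n.+1 < ep n.
Proof. by rewrite /ep exprS gtr_pMl ?ep_gt0// invf_lt1// ltr1n. Qed.

Let ep_le1 n : ep n <= 1.
Proof. by rewrite exprn_ile1// invf_le1// ler1n. Qed.

Let eta n := ep n `^ al.

Let eta_gt0 n : 0 < eta n. Proof. exact: powR_gt0. Qed.

Let etaS n : eta n.+1 < eta n.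
Proof. by rewrite gt0_ltr_powR ?nnegrE ?ltW. Qed.

Let eta_le1 n : eta n <= 1.
Proof.
have -> : 1 = 1 `^ al :> R by rewrite powR1.
by rewrite ge0_ler_powR ?nnegrE// ltW.
Qed.

Let chi : R -> R := \1_(`]0, b[%classic).

Let chi_int : integrableR chi.
Proof. exact: integrable_indic_itv. Qed.

Let chi_in t : t \in `]0, b[ -> chi t = 1.
Proof. by move=> tb; rewrite /chi indicE mem_set. Qed.

Let chi_out t : t \notin `]0, b[ -> chi t = 0.
Proof. by move=> tb; rewrite /chi indicE memNset//=; exact/negP. Qed.

(** The truncated equation.  The term [(A + 1) * eta n], supported in [0, b] and
    tending to zero, makes the solutions nonnegative and decreasing in [n]. *)
Let rhs n (y : R -> R) (t : R) :=
  a t * Num.max (y t) (ep n) `^ al + (r t + (A + 1) * eta n * chi t).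

Let regularized n : {y : R -> R | integrableR (rhs n y) /\
  forall t, y t = primitive (rhs n y) t}.
Proof.
apply: cid; apply: (@picard R b A (eta n / ep n) a
  (fun t => r t + (A + 1) * eta n * chi t) (fun x => Num.max x (ep n) `^ al)) => //.
- exact: divr_gt0.
- by apply: integrableR_add => //; exact: integrableR_scale.
- by move=> t tb; rewrite r_supp// chi_out// mulr0 addr0.
- by move=> x y; exact: powR_trunc_lipschitz.
Qed.

Let u n : R -> R := sval (regularized n).

Let u_int n : integrableR (rhs n (u n)).
Proof. exact: (svalP (regularized n)).1. Qed.

Let uE n : u n = primitive (rhs n (u n)).
Proof. by apply/funext => t; exact: (svalP (regularized n)).2. Qed.

Let rhs_supp n y t : t \notin `]0, b[ -> rhs n y t = 0.
Proof. by move=> tb; rewrite /rhs a_supp// r_supp// chi_out// !(mul0r, mulr0) !addr0. Qed.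

Let u_ac n x y : absolutely_continuous x y (u n).
Proof. by rewrite uE; exact: primitive_absolutely_continuous. Qed.

Let u_derive n : {ae (@lebesgue_measure R), forall t : R,
  is_derive t 1 (u n) (rhs n (u n) t)}.
Proof. by apply: ae_impl (primitive_is_derive (u_int n)) => t; rewrite -uE. Qed.

Let u0 n : u n 0 = 0.
Proof. by rewrite uE; apply: (@primitive_support _ _ b) => // t; exact: rhs_supp. Qed.

Let aA t : - A <= a t <= A.
Proof. by rewrite -ler_norml. Qed.

Let ac0 x y : absolutely_continuous x y (fun=> 0 : R).
Proof.
apply: (absolutely_continuous_bounded_increments (K := 0) (u_ac 0%N x y) (u_ac 0%N x y)).
by move=> *; rewrite subrr normr0 mul0r.
Qed.

Let u_ge0 n : forall t, 0 <= t <= b -> 0 <= u n t.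
Proof.
move=> t tb; rewrite -oppr_le0 -sub0r.
have acD x y := absolutely_continuousB (ac0 x y) (@u_ac n x y).
apply: (@nonpositive_of_derivative R b 1 (fun t => 0 - u n t)) => //.
- exact: absolutely_continuous_continuous.
- by rewrite u0 subrr.
apply: ae_impl (u_derive n) => x dx xb; exists (0 - rhs n (u n) x).
  by apply: is_deriveB.
rewrite !sub0r oppr_gt0 oppr_le0 => /andP[ux _].
rewrite /rhs chi_in// mulr1.
have -> : Num.max (u n x) (ep n) = ep n by apply/max_idPr; rewrite (le_trans (ltW ux))// ltW.
have := r_ge0 x; have /andP[h _] := aA x.
have aAx : 0 <= (a x + A) * eta n.
  by apply: mulr_ge0; [rewrite -lerBlDr sub0r|exact: ltW].
move: (eta_gt0 n) aAx; rewrite -/(eta n) !mulrDl mul1r; lra.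
Qed.

(** [nonpositive_of_derivative] is applied with [k] so small that
    [trunc_rhs_decreasing] holds as long as the difference is below [k]. *)
Let u_decr n : forall t, 0 <= t <= b -> u n.+1 t <= u n t.
Proof.
move=> t tb; rewrite -subr_le0.
have acD x y := absolutely_continuousB (@u_ac n.+1 x y) (@u_ac n x y).
pose L := eta n.+1 / ep n.+1.
have L0 : 0 < L by exact: divr_gt0.
have k0 : 0 < (eta n - eta n.+1) / (A * L) by rewrite divr_gt0 ?subr_gt0// pmulr_rgt0.
apply: (@nonpositive_of_derivative R b _ (fun t => u n.+1 t - u n t) k0) => //.
- exact: absolutely_continuous_continuous.
- by rewrite !u0 subrr.
apply: ae_impl2 (u_derive n) (u_derive n.+1) => x dx dx' xb.
exists (rhs n.+1 (u n.+1) x - rhs n (u n) x); first by apply: is_deriveB.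
have AL0 : 0 < A * L by rewrite pmulr_rgt0.
move=> /andP[D0]; rewrite ltr_pdivlMr// => Dk.
rewrite /rhs chi_in// !mulr1; apply: trunc_rhs_decreasing => //.
exact: ltW.
Qed.

(** The solutions of the truncated equations decrease to a limit, and dominated
    convergence carries the integral equation to it. *)
Theorem sublinear_existence : exists y : R -> R,
  integrableR (fun t => a t * Num.max (y t) 0 `^ al + r t) /\
  forall t, y t = primitive (fun t => a t * Num.max (y t) 0 `^ al + r t) t.
Proof.
have in_cc t : t \in `]0, b[ -> 0 <= t <= b.
  by rewrite in_itv/= => /andP[t0 tb]; rewrite !ltW.
have decr t : 0 <= t <= b -> nonincreasing_seq (u ^~ t).
  by move=> tb; apply/nonincreasing_seqP => n; exact: u_decr.
have cvgu t : t \in `]0, b[ -> cvgn (u ^~ t).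
  move=> /in_cc tb; apply: nonincreasing_is_cvgn; first exact: decr.
  by exists 0 => _ [n _ <-]; exact: u_ge0.
pose y t := limn (u ^~ t).
pose C := \int[@lebesgue_measure R]_x `|rhs 0 (u 0%N) x|.
have uC t : u 0%N t <= C.
  by rewrite uE; apply: (le_trans (ler_norm _)); exact: primitive_bounded.
have C0 : 0 <= C by exact: Rintegral_ge0.
(* All truncated solutions lie below the first one, which is at most [C], and
   all levels are at most 1; this bounds the integrands by [G]. *)
pose G t := (C + 1) `^ al * `|a t| + (`|r t| + (A + 1) * chi t).
have G_int : integrableR G.
  apply: integrableR_add; first by apply: integrableR_scale; exact: integrableR_norm.
  by apply: integrableR_add; [exact: integrableR_norm|exact: integrableR_scale].
have ep0 : ep n @[n --> \oo] --> 0.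
  by apply: cvg_expr; rewrite ger0_norm// invf_lt1// ltr1n.
have epmax n : ep n = Num.max (ep n) 0 by apply/esym/max_idPl; exact: ltW.
have eta0 : eta n @[n --> \oo] --> 0.
  have -> : eta = (fun n => Num.max (ep n) 0 `^ al) by apply/funext => n; rewrite -epmax.
  have m0 : 0 = Num.max 0 0 `^ al :> R by rewrite maxxx powR0// gt_eqF.
  rewrite [X in _ --> X]m0.
  exact: powR_max_cvg.
have A1 : 0 <= A + 1 by rewrite addr_ge0// ltW.
have key t : integrableR (fun t => a t * Num.max (y t) 0 `^ al + r t) /\
    primitive (rhs n (u n)) t @[n --> \oo] -->
      primitive (fun t => a t * Num.max (y t) 0 `^ al + r t) t.
  apply: (primitive_cvg (g := G)) => //.
    move=> n x; have [xb|xb] := boolP (x \in `]0, b[); last first.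
      by rewrite rhs_supp// normr0 /G !addr_ge0// ?mulr_ge0 ?powR_ge0// ?chi_out ?addr_ge0// ltW.
    rewrite /rhs /G chi_in// !mulr1; apply: (le_trans (ler_normD _ _)); apply: lerD.
      rewrite normrM mulrC ler_wpM2r// ger0_norm ?powR_ge0//.
      have m0 : 0 <= Num.max (u n x) (ep n) by rewrite le_max (ltW (ep_gt0 n)) orbT.
      rewrite ge0_ler_powR ?nnegrE ?(ltW al0)// ?addr_ge0// ge_max.
      have := decr x (in_cc x xb) 0%N n (leq0n n) => h.
      by rewrite (le_trans h) ?(le_trans (uC x)) ?lerDl// (le_trans (ep_le1 n))// lerDr.
    apply: (le_trans (ler_normD _ _)); rewrite lerD2l.
    by rewrite ger0_norm ?mulr_ge0 ?(ltW (eta_gt0 n))// ler_piMr.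
  move=> x; have [xb|xb] := boolP (x \in `]0, b[); last first.
    rewrite a_supp// r_supp// mul0r addr0.
    by under eq_fun do rewrite rhs_supp//; exact: cvg_cst.
  apply: cvgD; last first.
    rewrite -[X in _ --> X]addr0; apply: cvgD; first exact: cvg_cst.
    rewrite -(mul0r (chi x)) -(mulr0 (A + 1)).
    by apply: cvgMl; apply: cvgMr.
  apply: cvgMr.
  have -> : (fun n => Num.max (u n x) (ep n) `^ al) =
            (fun n => Num.max (Num.max (u n x) (ep n)) 0 `^ al).
    apply/funext => n; congr (_ `^ _); apply/esym/max_idPl.
    by rewrite le_max (ltW (ep_gt0 n)) orbT.
  have -> : Num.max (y x) 0 `^ al = Num.max (Num.max (y x) 0) 0 `^ al.
    by rewrite -maxA maxxx.
  apply: powR_max_cvg => //.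
  apply/cvgrPdist_lt => d d0; have d2 : 0 < d / 2 by rewrite divr_gt0.
  have /cvgrPdist_lt/(_ _ d2) h1 := cvgu x xb.
  have /cvgrPdist_lt/(_ _ d2) h2 := ep0.
  near=> n.
  have h3 : `|y x - u n x| < d / 2 by near: n.
  have h4 : `|0 - ep n| < d / 2 by near: n.
  apply: (le_lt_trans (max_contraction2 _ _ _ _)).
  by rewrite (splitr d) ltrD.
exists y; split; first exact: (key 0).1.
move=> t; apply: cvg_lim => //.
have [_] := key t; apply: cvg_trans; rewrite (_ : (fun n => u n t) = (fun n => primitive (rhs n (u n)) t))//.
by apply/funext => n; rewrite {1}uE.
Unshelve. all: by end_near. Qed.
End existence.

(** * Fronts and their comparison *)

(** A solution on [0, b] issued from zero, with the value at [b] left free; the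
    solutions of the auxiliary problem on [0, b] are the fronts vanishing at
    [b]. *)
Definition front (R : realType) (p p' : R) (f h : R -> R) (b c : R) (y : R -> R) :=
  [/\ absolutely_continuous 0 b y,
      {ae (@lebesgue_measure R), forall t, t \in `]0, b[ ->
        is_derive t 1 y (wave_rhs p p' f h c t (y t))},
      y 0 = 0 & forall t, t \in `]0, b[ -> 0 < y t].

(** The unknown in which the equation becomes additive in the speed and monotone
    where [f < 0].  The maximum makes it continuous without knowing the sign
    of [y]. *)
Definition gauge (R : realType) (p : R) (y : R -> R) (t : R) : R :=
  Num.max (y t) 0 `^ (1 - p^-1).

Section front_comparison.
Variables (R : realType) (p p' b : R) (f h : R -> R).
Hypotheses (p1 : 1 < p) (pp' : p^-1 + p'^-1 = 1).
Hypothesis f_neg : forall t, t \in `]0, b[ -> f t < 0.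

Let p0 : 0 < p. Proof. exact: lt_trans p1. Qed.
Let al0 : 0 < p^-1. Proof. by rewrite invr_gt0. Qed.
Let al1 : p^-1 < 1. Proof. by rewrite invf_lt1. Qed.
Let be0 : 0 < 1 - p^-1. Proof. by rewrite subr_gt0. Qed.
Let be1 : 1 - p^-1 < 1. Proof. by rewrite ltrBlDr ltrDl. Qed.
Let bep' : (1 - p^-1) * p' = 1.
Proof.
have be : 1 - p^-1 = p'^-1 by rewrite -pp' addrC addKr.
by rewrite be mulVf//; apply: contraTneq be0 => p'0; rewrite be p'0 invr0 ltxx.
Qed.

Lemma gauge_continuous c y : front p p' f h b c y ->
  {within `[0, b], continuous (gauge p y)}.
Proof.
move=> [acy _ _ _]; have /within_continuous_distP cy := absolutely_continuous_continuous acy.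
apply/within_continuous_distP => x xb e e0.
have /cvgrPdist_lt/(_ _ e0)/nbhs_dist[d d0 Hd] := @powR_max_continuous R _ be0 be1 (y x).
have [d' d'0 Hd'] := cy x xb d d0.
by exists d' => // z zb zx; rewrite distrC; apply: Hd; exact: Hd'.
Qed.

(** Inside the interval [y] is bounded below by a positive constant, where the
    power is Lipschitz; at 0 the gauge is merely continuous. *)
Lemma gauge_absolutely_continuous c y u v : front p p' f h b c y ->
  0 < u -> u <= v -> v < b -> absolutely_continuous u v (gauge p y).
Proof.
move=> [acy _ _ y0] u0 uv vb.
have acuv : absolutely_continuous u v y.
  by apply: absolutely_continuousS acy; rewrite ltW.
have [x xuv xmin] := EVT_min uv (absolutely_continuous_continuous acuv).
have yx0 : 0 < y x.
  by apply: y0; rewrite in_itv/= (lt_le_trans u0) ?(itvP xuv)// (le_lt_trans _ vb)// (itvP xuv).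
apply: (absolutely_continuous_bounded_increments
  (K := y x `^ (1 - p^-1) / y x) acuv acuv) => z w uz zw wv.
have ge t : u <= t <= v -> y x <= y t by move=> tuv; apply: xmin; rewrite in_itv.
have yz : y x <= y z by apply: ge; rewrite uz (le_trans zw).
have yw : y x <= y w by apply: ge; rewrite wv (le_trans uz).
rewrite /gauge.
have -> : Num.max (y z) 0 = y z by apply/max_idPl; rewrite (le_trans (ltW yx0)).
have -> : Num.max (y w) 0 = y w by apply/max_idPl; rewrite (le_trans (ltW yx0)).
apply: (le_trans (powR_lipschitz be0 be1 yx0 yw yz)).
by rewrite ler_wpM2l ?divr_ge0 ?powR_ge0 ?(ltW yx0)// lerDl.
Qed.

(** The chain rule; the factor [p'] cancels because it is conjugate to [p]. *)
Lemma gauge_is_derive c y : front p p' f h b c y ->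
  {ae (@lebesgue_measure R), forall t, t \in `]0, b[ ->
     is_derive t 1 (gauge p y) (c - h t - f t * y t `^ (- p^-1))}.
Proof.
move=> [_ dy _ y0]; apply: ae_impl dy => t dyt tb; have {}dyt := dyt tb.
have yt := y0 t tb.
apply: (@near_eq_is_derive _ _ _ (fun t => y t `^ (1 - p^-1))).
- have cy : {for t, continuous y}.
    by apply/differentiable_continuous/derivable1_diffP; case: dyt.
  have /cvgrPdist_lt/(_ _ yt) posy := cy.
  apply: filterS posy => x /ltr_normlW; rewrite ltrBlDr ltrDl => yx.
  by rewrite /gauge (max_idPl (ltW yx)).
- have := @is_derive1_comp R (fun x => x `^ (1 - p^-1)) y t _ _ (is_derive1_powR (1 - p^-1) yt) dyt.
  rewrite /comp => dW; apply: (is_derive_eq dW).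
  rewrite /wave_rhs.
  have -> : 1 - p^-1 - 1 = - p^-1 by rewrite addrC addKr.
  have yy : y t `^ (- p^-1) * y t `^ p^-1 = 1.
    by rewrite powRN mulVf// powR_eq0 negb_and gt_eqF.
  set q := y t `^ (- p^-1) in yy *; set q' := y t `^ p^-1 in yy *.
  transitivity ((1 - p^-1) * p' * ((c - h t) * (q * q') - f t * q)); first by ring.
  by rewrite yy bep' mulr1 mul1r.
Qed.

(** Where the first gauge is larger, so is [y1], and the term
    [- f y ^ (- 1/p)] then works against the difference since [f < 0]; only the
    difference of the speeds can make it grow. *)
Theorem front_gap c1 c2 y1 y2 :
  front p p' f h b c1 y1 -> front p p' f h b c2 y2 ->
  forall t, 0 <= t <= b ->
  gauge p y1 t - gauge p y2 t <= Num.max (c1 - c2) 0 * t.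
Proof.
move=> F1 F2 t tb; rewrite -subr_le0; set g := Num.max _ _.
have g0 : 0 <= g by rewrite le_max lexx orbT.
have gc : c1 - c2 <= g by rewrite le_max lexx.
pose D t := gauge p y1 t - gauge p y2 t - g * t.
apply: (@nonpositive_of_derivative R b 1 D) => //.
- apply: within_continuousB.
    by apply: within_continuousB; [exact: gauge_continuous F1|exact: gauge_continuous F2].
  exact: absolutely_continuous_continuous (absolutely_continuous_scale g 0 b).
- rewrite /D /gauge; have [_ _ -> _] := F1; have [_ _ -> _] := F2.
  by rewrite mulr0 !subrr.
- move=> u v u0 uv vb.
  apply: absolutely_continuousB; last exact: absolutely_continuous_scale.
  apply: absolutely_continuousB.
    exact: gauge_absolutely_continuous F1 _ _ _.
  exact: gauge_absolutely_continuous F2 _ _ _.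
apply: ae_impl2 (gauge_is_derive F1) (gauge_is_derive F2) => x d1 d2 xb.
have {}d1 := d1 xb; have {}d2 := d2 xb.
exists ((c1 - h x - f x * y1 x `^ (- p^-1)) - (c2 - h x - f x * y2 x `^ (- p^-1)) - g).
  exact: is_derive_sub (is_derive_sub d1 d2) (is_derive_scale g x).
move=> /andP[D0 _].
have x0 : 0 <= x by rewrite ltW// (itvP xb).
have [_ _ _ /(_ x xb) y10] := F1; have [_ _ _ /(_ x xb) y20] := F2.
have y21 : y2 x <= y1 x.
  rewrite leNgt; apply/negP => y12; suff : D x <= 0 by rewrite leNgt D0.
  rewrite /D /gauge; have -> : Num.max (y1 x) 0 = y1 x by apply/max_idPl/ltW.
  have -> : Num.max (y2 x) 0 = y2 x by apply/max_idPl/ltW.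
  have : 0 <= g * x by rewrite mulr_ge0.
  have : y1 x `^ (1 - p^-1) <= y2 x `^ (1 - p^-1).
    by rewrite ge0_ler_powR ?nnegrE ?(ltW be0)// ltW.
  by lra.
have hq : y1 x `^ (- p^-1) <= y2 x `^ (- p^-1).
  rewrite !powRN lef_pV2 ?posrE ?powR_gt0//.
  by rewrite ge0_ler_powR ?nnegrE ?(ltW al0)// ltW.
have := f_neg xb.
move: hq; set q1 := y1 x `^ _; set q2 := y2 x `^ _ => hq fx.
have : f x * (q2 - q1) <= 0 by rewrite mulr_le0_ge0 ?subr_ge0// ltW.
by rewrite mulrBr; lra.
Qed.

(** The term [- f y ^ (- 1/p)] is nonnegative, so the gauge grows at least at
    rate [c - H]. *)
Lemma front_growth c y (H : R) : front p p' f h b c y -> 0 <= b ->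
  (forall t, t \in `]0, b[ -> h t <= H) -> (c - H) * b <= gauge p y b.
Proof.
move=> F b0 hH; rewrite -subr_le0.
pose D t := (c - H) * t - gauge p y t.
apply: (@nonpositive_of_derivative R b 1 D); rewrite ?b0 ?lexx//.
- apply: within_continuousB; last exact: gauge_continuous F.
  exact: absolutely_continuous_continuous (absolutely_continuous_scale (c - H) 0 b).
- rewrite /D /gauge; have [_ _ -> _] := F; rewrite mulr0 maxxx sub0r oppr_le0.
  exact: powR_ge0.
- move=> u v u0 uv vb; apply: absolutely_continuousB.
    exact: absolutely_continuous_scale.
  exact: gauge_absolutely_continuous F _ _ _.
apply: ae_impl (gauge_is_derive F) => x d1 xb; have {}d1 := d1 xb.
exists ((c - H) - (c - h x - f x * y x `^ (- p^-1))).
  exact: is_derive_sub (is_derive_scale (c - H) x) d1.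
move=> _; have := hH x xb.
have : f x * y x `^ (- p^-1) <= 0 by rewrite mulr_le0_ge0 ?powR_ge0// ltW// f_neg.
by lra.
Qed.

Lemma front_end_ge0 c y : front p p' f h b c y -> 0 < b -> 0 <= y b.
Proof.
move=> [acy _ _ y0] b0; rewrite leNgt; apply/negP => yb.
have /within_continuous_distP cy := absolutely_continuous_continuous acy.
have [||d d0 Hd] := cy b _ (- y b); rewrite ?oppr_gt0 ?lexx ?(ltW b0)//.
pose m := Num.min (d / 2) (b / 2).
have m0 : 0 < m by rewrite lt_min !divr_gt0.
have [md mb] : m <= d / 2 /\ m <= b / 2 by split; rewrite ge_min lexx ?orbT.
have bm : 0 < b - m by lra.
have : 0 < y (b - m) by apply: y0; rewrite in_itv/= bm/=; lra.
have : `|y (b - m) - y b| < - y b.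
  apply: Hd; first by apply/andP; split; lra.
  by rewrite ler0_norm; lra.
by move/ltr_normlW; lra.
Qed.

Lemma front_unique c y1 y2 : front p p' f h b c y1 -> front p p' f h b c y2 -> 0 < b ->
  forall t, 0 <= t <= b -> y1 t = y2 t.
Proof.
move=> F1 F2 b0.
have le12 t z1 z2 : front p p' f h b c z1 -> front p p' f h b c z2 ->
    0 <= t <= b -> gauge p z1 t <= gauge p z2 t.
  move=> G1 G2 tb; have := front_gap G1 G2 tb.
  by rewrite subrr maxxx mul0r subr_le0.
have nn t z : front p p' f h b c z -> 0 <= t <= b -> 0 <= z t.
  move=> G /andP[]; rewrite le_eqVlt => /predU1P[<- _|t0].
    by have [_ _ ->] := G.
  rewrite le_eqVlt => /predU1P[->|tb]; first exact: front_end_ge0 G _.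
  by rewrite ltW//; have [_ _ _] := G; apply; rewrite in_itv/= t0.
move=> t tb; have e : gauge p y1 t = gauge p y2 t by apply: le_anti; rewrite !le12.
have n1 := nn t y1 F1 tb; have n2 := nn t y2 F2 tb.
apply: (powR_injective be0); rewrite ?nnegrE//.
by move: e; rewrite /gauge !(max_idPl _).
Qed.
End front_comparison.

(** * Existence of fronts *)

Section front_existence.
Variables (R : realType) (p p' b H c : R) (f h : R -> R).
Hypotheses (p1 : 1 < p) (pp' : p^-1 + p'^-1 = 1) (b0 : 0 < b).
Hypothesis h_meas : measurable_fun `]0, b[ h.
Hypothesis h_bnd : forall t, t \in `]0, b[ -> `|h t| <= H.
Hypothesis f_int : (@lebesgue_measure R).-integrable `]0, b[ (EFin \o f).
Hypothesis f_loc : forall t, t \in `]0, b[ ->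
  exists2 m : R, m < 0 & \forall x \near t, f x < m.

Let f_neg t : t \in `]0, b[ -> f t < 0.
Proof.
by move=> /f_loc[m m0 fm]; apply: lt_trans m0; exact: nbhs_singleton fm.
Qed.

Let al0 : 0 < p^-1. Proof. by rewrite invr_gt0 (lt_trans _ p1). Qed.
Let al1 : p^-1 < 1. Proof. by rewrite invf_lt1// (lt_trans _ p1). Qed.
Let p'0 : 0 < p'.
Proof.
have : 0 < p'^-1 by move: al1 pp'; lra.
by rewrite invr_gt0.
Qed.

Let I : set R := `]0, b[%classic.
Let a : R -> R := (fun t => p' * (c - h t)) \_ I.
Let r : R -> R := (fun t => - p' * f t) \_ I.

Let in_I t : t \in `]0, b[ -> a t = p' * (c - h t) /\ r t = - p' * f t.
Proof. by move=> tb; rewrite /a /r !patchE mem_set. Qed.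

Let out_I t : t \notin `]0, b[ -> a t = 0 /\ r t = 0.
Proof. by move=> tb; rewrite /a /r !patchE memNset//=; exact/negP. Qed.

Let r_int : integrableR r.
Proof.
have mI : measurable I by exact: measurable_itv.
rewrite /r -restrict_EFin; apply/(integrable_mkcond _ _).1; first exact: mI.
by apply: eq_integrable (integrableZl _ (- p') f_int).
Qed.

Let A : R := p' * (`|c| + `|H|) + 1.

Let A0 : 0 < A.
Proof. by rewrite ltr_wpDl// mulr_ge0 ?addr_ge0// ltW. Qed.

Let a_bnd t : `|a t| <= A.
Proof.
have [tb|tb] := boolP (t \in `]0, b[); last by rewrite (out_I tb).1 normr0 ltW.
rewrite (in_I tb).1 normrM gtr0_norm// ler_wpDr// ler_wpM2l ?(ltW p'0)//.
rewrite (le_trans (ler_normB _ _))// lerD2l (le_trans (h_bnd tb))//.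
exact: ler_norm.
Qed.

Let a_int : integrableR a.
Proof.
have mI : measurable I by exact: measurable_itv.
rewrite /a -restrict_EFin; apply/(integrable_mkcond _ _).1; first exact: mI.
apply: measurable_bounded_integrable => //.
- by rewrite /= lebesgue_measure_itv/= lte_fin b0 -EFinB ltry.
- apply: measurable_funM => //; apply: measurable_funB => //.
- exists A; split; [exact: num_real|move=> M AM t tb].
  by rewrite /= -(in_I tb).1 (le_trans (a_bnd t))// ltW.
Qed.

(** [sublinear_existence] gives a solution with [y = 0] at 0.  It is nonnegative
    because its derivative is [- p' f > 0] wherever it is negative.  If it
    vanished at an interior point [t], then near [t] the sublinear term would be
    small while [- f] stays bounded below, so [y] would increase strictly up to
    [t] and be negative just before. *)
Theorem front_exists : exists y, front p p' f h b c y.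
Proof.
have [|y [y_int yE]] := @sublinear_existence R b p^-1 A a r al0 al1 A0 a_int r_int a_bnd
  (fun t tb => (out_I tb).1) (fun t tb => (out_I tb).2).
  move=> t; have [tb|tb] := boolP (t \in `]0, b[); last by rewrite (out_I tb).2.
  by rewrite (in_I tb).2 mulr_le0 ?oppr_le0 ?(ltW p'0)// ltW// f_neg.
set rhs := (fun t => a t * Num.max (y t) 0 `^ p^-1 + r t) in y_int yE.
have {}yE : y = primitive rhs by apply/funext.
have acy u v : absolutely_continuous u v y.
  by rewrite yE; exact: primitive_absolutely_continuous.
have cy : continuous y by rewrite yE; exact: primitive_continuous.
have dy : {ae (@lebesgue_measure R), forall t : R, is_derive t 1 y (rhs t)}.
  by apply: ae_impl (primitive_is_derive y_int) => t; rewrite -yE.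
have y0 : y 0 = 0.
  rewrite yE; apply: (@primitive_support _ _ b) => // t tb.
  by rewrite /rhs (out_I tb).1 (out_I tb).2 mul0r addr0.
have rhsE t : t \in `]0, b[ ->
    rhs t = p' * (c - h t) * Num.max (y t) 0 `^ p^-1 - p' * f t.
  by move=> tb; rewrite /rhs (in_I tb).1 (in_I tb).2 mulNr.
have y_ge0 t : 0 <= t <= b -> 0 <= y t.
  move=> tb; suff : 0 * t - y t <= 0 by rewrite mul0r sub0r oppr_le0.
  have acD u v := absolutely_continuousB (absolutely_continuous_scale 0 u v) (acy u v).
  apply: (@nonpositive_of_derivative R b 1 (fun t => 0 * t - y t)) => //.
  - exact: absolutely_continuous_continuous.
  - by rewrite y0 mul0r subrr.
  apply: ae_impl dy => x dx xb; exists (0 - rhs x).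
    exact: is_derive_sub (is_derive_scale 0 x) dx.
  rewrite mul0r !sub0r oppr_gt0 oppr_le0 => /andP[yx _].
  rewrite rhsE// (max_idPr (ltW yx)) powR0 ?gt_eqF// mulr0 sub0r -mulrN.
  by rewrite mulr_ge0 ?(ltW p'0)// oppr_ge0 ltW// f_neg.
have y_gt0 t : t \in `]0, b[ -> 0 < y t.
  move=> tb; rewrite lt_neqAle y_ge0 ?andbT; last by rewrite !ltW ?(itvP tb).
  apply/eqP => yt.
  have [m m0 fm] := f_loc tb.
  (* Near [t] one has [- p' f > 2 k] and the sublinear term is at most [k] in
     absolute value, so [y' >= k]. *)
  pose k := - (p' * m) / 2.
  have k0 : 0 < k by rewrite divr_gt0// oppr_gt0 pmulr_rlt0.
  have kA : 0 < k / A by rewrite divr_gt0.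
  have gcy : {for t, continuous (fun x => Num.max (y x) 0 `^ p^-1)}.
    exact: (continuous_comp (cy t) (@powR_max_continuous R _ al0 al1 (y t))).
  have /cvgrPdist_lt/(_ _ kA) small := gcy.
  have [d d0 Hd] : exists2 d : R, 0 < d & forall x, `|x - t| < d ->
      f x < m /\ `|Num.max (y t) 0 `^ p^-1 - Num.max (y x) 0 `^ p^-1| < k / A.
    by apply: nbhs_dist; apply: filterS2 fm small => x ? ?; split.
  have [t0 t1] : 0 < t /\ t < b by rewrite !(itvP tb).
  pose n := Num.min (d / 2) (t / 2).
  have n0 : 0 < n by rewrite lt_min !divr_gt0.
  have [nd nt] : n <= d / 2 /\ n <= t / 2 by split; rewrite ge_min lexx ?orbT.
  have tn : t - n <= t by rewrite gerBl ltW.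
  have : k * t - y t <= k * (t - n) - y (t - n).
    apply: (@absolutely_continuous_nonincreasing R (t - n) t (fun x => k * x - y x)) => //.
      by apply: absolutely_continuousB => //; exact: absolutely_continuous_scale.
    apply: ae_impl dy => x dx; rewrite in_itv/= => /andP[x1 x2].
    exists (k - rhs x); first exact: is_derive_sub (is_derive_scale k x) dx.
    have xb : x \in `]0, b[ by rewrite in_itv/=; apply/andP; split; lra.
    have [|fx gx] := Hd x; first by rewrite ler0_norm; lra.
    rewrite -yt maxxx powR0 ?gt_eqF// sub0r normrN in gx.
    have ag : `|a x * Num.max (y x) 0 `^ p^-1| <= k.
      rewrite normrM [leRHS](_ : k = A * (k / A)); last by rewrite mulrC divfK// gt_eqF.
      by apply: ler_pM => //; exact: ltW.
    have fm' : p' * f x <= p' * m by rewrite ler_wpM2l ?ltW.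
    move: ag fm'; rewrite rhsE// -(in_I xb).1 => /ler_normlP[ag _] fm'.
    by rewrite /k in ag *; lra.
  have := y_ge0 (t - n); rewrite mulrBr -yt.
  have : 0 < k * n by rewrite mulr_gt0.
  have -> : 0 <= t - n <= b by apply/andP; split; lra.
  by move=> ? /(_ isT) ?; lra.
exists y; split => //.
apply: ae_impl dy => x dx xb; apply: (is_derive_eq dx).
rewrite rhsE// /wave_rhs (max_idPl (ltW (y_gt0 x xb))).
by ring.
Qed.
End front_existence.

(** * Reflection of the interval *)

(** Typed on the measurable line, so that the push-forward of Lebesgue measure
    along it is recognised as a measure. *)
Definition reflection (R : realType) (m : R) : measurableTypeR R -> measurableTypeR R :=
  fun x => m - x.

Lemma measurable_reflection (R : realType) (m : R) : measurable_fun setT (reflection m).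
Proof. exact: measurable_funB. Qed.

HB.instance Definition _ (R : realType) (m : R) :=
  isMeasurableFun.Build _ _ _ _ (reflection m) (measurable_reflection m).

Lemma lebesgue_measure_reflection (R : realType) (m : R) (A : set R) : measurable A ->
  pushforward (@lebesgue_measure R) (reflection m) A = @lebesgue_measure R A.
Proof.
move=> mA; apply/esym/lebesgue_measure_unique => //= _ [[a b]] _ <-.
rewrite /pushforward /=.
have -> : reflection m @^-1` `]a, b] = [set` `[m - b, m - a[ ] :> set R.
  by apply/seteqP; split => x /=; rewrite /reflection !in_itv/= => /andP[? ?];
    apply/andP; split; lra.
rewrite !lebesgue_measure_itv/= !lte_fin ltrD2l ltrN2.
by case: ifP => // _; rewrite -EFinB; congr (_%:E); ring.
Qed.

Lemma ae_reflection (R : realType) (m : R) (P : R -> Prop) :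
  {ae (@lebesgue_measure R), forall t, P t} ->
  {ae (@lebesgue_measure R), forall t, P (m - t)}.
Proof.
move=> [N [mN N0 PN]]; exists (reflection m @^-1` N); split.
- by rewrite -[X in measurable X]setTI; exact: measurable_reflection.
- by rewrite -[RHS]N0; exact: lebesgue_measure_reflection.
- by move=> t /= nP; apply: PN.
Qed.

Lemma integrable_reflection (R : realType) (m : R) (A B : set R) (f : R -> R) :
  measurable A -> measurable B -> (forall t, B t -> A (m - t)) ->
  (@lebesgue_measure R).-integrable A (EFin \o f) ->
  (@lebesgue_measure R).-integrable B (EFin \o (fun t => f (m - t))).
Proof.
move=> mA mB BA /integrableP[mf fi].
have mA' : measurable (reflection m @^-1` A : set R).
  by rewrite -[X in measurable X]setTI; exact: measurable_reflection.
apply: (@integrableS _ _ _ _ (reflection m @^-1` A)) => //.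
apply/integrableP; split.
  apply: (@measurable_comp _ _ _ _ _ _ A (EFin \o f) _ (reflection m)) => //.
    by move=> _ [x /= Ax <-].
  exact: measurable_funTS (measurable_reflection m).
apply: le_lt_trans fi; rewrite le_eqVlt; apply/orP; left; apply/eqP.
transitivity (\int[pushforward (@lebesgue_measure R) (reflection m)]_(x in A) `|(EFin \o f) x|)%E.
  rewrite ge0_integral_pushforward//.
  exact: measurableT_comp.
by apply: eq_measure_integral => S mS _; exact: lebesgue_measure_reflection.
Qed.

(** Reflecting the interval changes the sign of the derivative, which is absorbed
    by [c], [h] and [f]. *)
Lemma wave_solution_reflection (R : realType) (p p' c a b : R) (f h y : R -> R) :
  {ae (@lebesgue_measure R), forall t, t \in `]a, b[ ->
    is_derive t 1 y (wave_rhs p p' f h c t (y t))} ->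
  {ae (@lebesgue_measure R), forall t, t \in `]1 - b, 1 - a[ ->
    is_derive t 1 (fun x => y (1 - x))
     (wave_rhs p p' (fun x => - f (1 - x)) (fun x => - h (1 - x)) (- c) t (y (1 - t)))}.
Proof.
move=> dy; apply: ae_impl (ae_reflection 1 dy) => t dyt tab.
have {}dyt : is_derive (1 - t) 1 y (wave_rhs p p' f h c (1 - t) (y (1 - t))).
  by apply: dyt; move: tab; rewrite !in_itv/= => /andP[? ?]; apply/andP; split; lra.
have dr : is_derive t 1 (fun x : R => 1 - x) (0 - 1).
  by apply: (@is_derive_sub R (fun=> 1) id t 0 1).
have := @is_derive1_comp R y (fun x => 1 - x) t _ _ dyt dr.
rewrite /comp => d; apply: (is_derive_eq d).
by rewrite /wave_rhs sub0r; ring.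
Qed.

(** The half-open pieces [k j, k j.+1[ cover the interval, and each of them is a
    point followed by an open interval of continuity. *)
Lemma piecewise_continuous_measurable (R : realType) (q : nat) (k : nat -> R) (h : R -> R) :
  (forall j, (j <= q)%N -> {in `]k j, k j.+1[, continuous h}) ->
  measurable_fun `]k 0%N, k q.+1[ h.
Proof.
move=> hc.
pose E (j : nat) : set R := if (j <= q)%N then `[k j, k j.+1[%classic else set0.
have mE j : measurable (E j) by rewrite /E; case: ifP.
apply: (@measurable_funS _ _ _ _ (\bigcup_j E j)); first exact: bigcup_measurable.
  have cover n x : k 0%N <= x < k n -> exists2 j, (j < n)%N & k j <= x < k j.+1.
    elim: n => [|n IH]; first by move=> /andP[kx xk]; have := le_lt_trans kx xk; rewrite ltxx.
    move=> /andP[kx xk]; have [xn|nx] := ltP x (k n).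
      by have [|j jn xj] := IH; [rewrite kx|exists j => //; exact: ltnW].
    by exists n; rewrite // nx.
  move=> x /=; rewrite in_itv/= => /andP[x0 x1].
  have [|j jq xj] := cover q.+1 x; first by rewrite ltW.
  by exists j => //; rewrite /E -ltnS jq /= in_itv.
apply/measurable_fun_bigcup => // j; rewrite /E; case: ifP => [jq|_]; last exact: measurable_fun_set0.
have [kj|kj] := ltP (k j) (k j.+1); last first.
  by rewrite set_itv_ge ?bnd_simp -?leNgt//; exact: measurable_fun_set0.
rewrite -(@setU1itv _ _ _ _ false) ?bnd_simp//; apply/measurable_funU => //; split.
  exact: measurable_fun_set1.
apply: subspace_continuous_measurable_fun => //.
by rewrite continuous_open_subspace; [move=> x; rewrite inE; exact: hc|exact: interval_open].
Qed.

Lemma absolutely_continuous_reflect1 (R : realType) (a b : R) (y : R -> R) :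
  absolutely_continuous a b y -> absolutely_continuous (1 - b) (1 - a) (fun t => y (1 - t)).
Proof. exact: absolutely_continuous_reflect. Qed.

(** The mirror image of [front]: a solution on [s, 1] issued from 1, with the
    value at [s] left free. *)
Definition back_front (R : realType) (p p' : R) (f h : R -> R) (s c : R) (y : R -> R) :=
  [/\ absolutely_continuous s 1 y,
      {ae (@lebesgue_measure R), forall t, t \in `]s, 1[ ->
        is_derive t 1 y (wave_rhs p p' f h c t (y t))},
      y 1 = 0 & forall t, t \in `]s, 1[ -> 0 < y t].

Lemma front_of_back (R : realType) (p p' s c : R) (f h y : R -> R) :
  back_front p p' f h s c y ->
  front p p' (fun x => - f (1 - x)) (fun x => - h (1 - x)) (1 - s) (- c)
    (fun t => y (1 - t)).
Proof.
move=> [acy dy y1 y0]; split.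
- by have := absolutely_continuous_reflect1 acy; rewrite subrr.
- by have := wave_solution_reflection dy; rewrite subrr.
- by rewrite subr0.
- move=> t; rewrite in_itv/= => /andP[? ?]; apply: y0.
  by rewrite in_itv/=; apply/andP; split; lra.
Qed.

Lemma back_of_front (R : realType) (p p' s c : R) (f h y : R -> R) :
  front p p' (fun x => - f (1 - x)) (fun x => - h (1 - x)) (1 - s) (- c) y ->
  back_front p p' f h s c (fun t => y (1 - t)).
Proof.
move=> [acy dy y1 y0]; split.
- by have := absolutely_continuous_reflect1 acy; rewrite subr0 subKr.
- have := wave_solution_reflection dy; rewrite subr0 subKr; apply: ae_impl => t dt ts.
  apply: (is_derive_eq (dt ts)).
  by rewrite /wave_rhs !opprK !subKr.
- by rewrite subrr.
- move=> t; rewrite in_itv/= => /andP[? ?]; apply: y0.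
  by rewrite in_itv/=; apply/andP; split; lra.
Qed.

(** The local form in which semicontinuity and the sign of [f] are used. *)
Lemma usc_locally_negative (R : realType) (a b : R) (f : R -> R) :
  usc_on `]a, b[ f -> (forall t, t \in `]a, b[ -> f t < 0) ->
  forall t, t \in `]a, b[ -> exists2 m : R, m < 0 & \forall x \near t, f x < m.
Proof.
move=> usc f0 t tab; have ft := f0 t tab.
have ftm : f t < f t / 2 by lra.
exists (f t / 2); first by lra.
have [|V nV Vf] := usc t (f t / 2); first by rewrite /= lte_fin.
move: nV; rewrite /nbhs/= -nbhs_subspace_in; last exact: tab.
move=> nVab; have nV : \forall x \near t, x \in `]a, b[ -> V x by exact: nVab.
have nab : \forall x \near t, x \in `]a, b[ by exact: near_in_itvoo.
apply: filterS2 nV nab => x xV xab.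
by rewrite -lte_fin; apply: Vf; exact: xV.
Qed.

Lemma lsc_locally_negative (R : realType) (a b m : R) (f : R -> R) :
  lsc_on `]a, b[ f -> (forall t, t \in `]a, b[ -> 0 < f t) ->
  forall t, t \in `]m - b, m - a[ ->
    exists2 l : R, l < 0 & \forall x \near t, - f (m - x) < l.
Proof.
move=> lsc f0 t tab.
have tab' : m - t \in `]a, b[.
  by move: tab; rewrite !in_itv/= => /andP[? ?]; apply/andP; split; lra.
have ft := f0 _ tab'.
have ftm : f (m - t) / 2 < f (m - t) by lra.
exists (- (f (m - t) / 2)); first by lra.
have [|V nV Vf] := lsc (m - t) (f (m - t) / 2); first by rewrite /= lte_fin.
move: nV; rewrite /nbhs/= -nbhs_subspace_in; last exact: tab'.
move=> nVab; have nV : \forall x \near m - t, x \in `]a, b[ -> V x by exact: nVab.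
have nab : \forall x \near m - t, x \in `]a, b[ by exact: near_in_itvoo.
have W : \forall x \near m - t, f (m - t) / 2 < f x.
  apply: filterS2 nV nab => x xV xab.
  by rewrite -lte_fin; apply: Vf; exact: xV.
have cr : {for t, continuous (fun x : R => m - x)}.
  by apply: cvgB; [exact: cvg_cst|exact: cvg_id].
have nW : \forall x \near t, f (m - t) / 2 < f (m - x) by exact: (cr _ W).
by apply: filterS nW => x; rewrite ltrN2.
Qed.

Lemma absolutely_continuous_ext (R : realType) (a b : R) (F G : R -> R) :
  (forall t, a <= t <= b -> F t = G t) ->
  absolutely_continuous a b F -> absolutely_continuous a b G.
Proof.
move=> FG acF; apply: (absolutely_continuous_bounded_increments (K := 1) acF acF).
move=> x y ax xy yb; rewrite -!FG ?ax ?yb ?(le_trans ax)// ?(le_trans xy)//.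
by rewrite mul1r lerDl.
Qed.

Lemma ae_solution_ext (R : realType) (g : R -> R -> R) (a b : R) (F G : R -> R) :
  (forall t, t \in `]a, b[ -> F t = G t) ->
  {ae (@lebesgue_measure R), forall t, t \in `]a, b[ -> is_derive t 1 F (g t (F t))} ->
  {ae (@lebesgue_measure R), forall t, t \in `]a, b[ -> is_derive t 1 G (g t (G t))}.
Proof.
move=> FG; apply: ae_impl => t dt tab; rewrite -FG//.
apply: (@near_eq_is_derive _ _ _ F); last exact: dt.
have nab : \forall x \near t, x \in `]a, b[ by exact: near_in_itvoo.
by apply: filterS nab => x; exact: FG.
Qed.

(** * Matching the two fronts *)

Section matching_fronts.
Variables (R : realType) (p p' s H : R) (f h : R -> R).
Hypotheses (p1 : 1 < p) (pp' : p^-1 + p'^-1 = 1) (s0 : 0 < s) (s1 : s < 1).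
Hypothesis f_int : (@lebesgue_measure R).-integrable `]0, 1[ (EFin \o f).
Hypothesis f_neg : forall t, t \in `]0, s[ -> f t < 0.
Hypothesis f_pos : forall t, t \in `]s, 1[ -> 0 < f t.
Hypothesis f_usc : usc_on `]0, s[ f.
Hypothesis f_lsc : lsc_on `]s, 1[ f.
Hypothesis h_bnd : forall t, 0 <= t <= 1 -> `|h t| <= H.
Hypothesis h_meas : measurable_fun (`]0, 1[%classic : set R) h.

Let itv_left : `]0, s[%classic `<=` (`]0, 1[%classic : set R).
Proof. by apply: subset_itvl; rewrite bnd_simp ltW. Qed.

Let fr (x : R) : R := - f (1 - x).
Let hr (x : R) : R := - h (1 - x).

Let be0 : 0 < 1 - p^-1. Proof. by rewrite subr_gt0 invf_lt1// (lt_trans _ p1). Qed.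

Let s1' : 0 < 1 - s. Proof. by rewrite subr_gt0. Qed.

Let fr_neg t : t \in `]0, 1 - s[ -> fr t < 0.
Proof.
rewrite in_itv/= => /andP[t0 ts]; rewrite oppr_lt0; apply: f_pos.
by rewrite in_itv/=; apply/andP; move: s0 s1; split; lra.
Qed.

Let left_exists c : {y | front p p' f h s c y}.
Proof.
apply: cid; apply: (@front_exists R p p' s H c f h) => //.
- by apply: (@measurable_funS _ _ _ _ (`]0, 1[%classic : set R))  => //; exact: itv_left.
- by move=> t; rewrite in_itv/= => /andP[? ?]; apply: h_bnd; apply/andP; move: s0 s1; split; lra.
- by apply: integrableS f_int => //; exact: itv_left.
- exact: usc_locally_negative f_usc f_neg.
Qed.

Let right_exists c : {y | front p p' fr hr (1 - s) c y}.
Proof.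
apply: cid; apply: (@front_exists R p p' (1 - s) H c fr hr) => //.
- apply: measurableT_comp => //.
  apply: (@measurable_comp _ _ _ _ _ _ (`]0, 1[%classic : set R) h _ (reflection 1)) => //.
    by move=> _ [x /= + <-]; rewrite /reflection !in_itv/= => /andP[? ?]; apply/andP; move: s0 s1; split; lra.
  by apply: measurable_funTS; exact: measurable_reflection.
- move=> t; rewrite in_itv/= => /andP[? ?]; rewrite normrN; apply: h_bnd.
  by apply/andP; move: s0 s1; split; lra.
- have fi : (@lebesgue_measure R).-integrable `]0, 1 - s[ (EFin \o (fun t => f (1 - t))).
    apply: (@integrable_reflection R 1 (`]0, 1[%classic : set R) _ f) => //.
    by move=> t /=; rewrite !in_itv/= => /andP[? ?]; apply/andP; move: s0 s1; split; lra.
  apply: eq_integrable (integrableZl _ (- 1) fi) => // t _.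
  by rewrite /= -EFinM mulN1r.
- by move=> t ts; apply: (lsc_locally_negative f_lsc f_pos); rewrite subrr.
Qed.

Let Y c := sval (left_exists c).
Let Z c := sval (right_exists (- c)).
Let FY c : front p p' f h s c (Y c). Proof. exact: svalP. Qed.
Let FZ c : front p p' fr hr (1 - s) (- c) (Z c). Proof. exact: svalP. Qed.

Let s_in : 0 <= s <= s. Proof. by rewrite lexx ltW. Qed.
Let s_in' : 0 <= 1 - s <= 1 - s. Proof. by rewrite lexx ltW. Qed.

Let phi c := gauge p (Y c) s.
Let psi c := gauge p (Z c) (1 - s).

Let gapY c d : phi c - phi d <= Num.max (c - d) 0 * s.
Proof. exact: (front_gap p1 pp' f_neg (FY c) (FY d) s_in). Qed.

Let gapZ c d : psi c - psi d <= Num.max (d - c) 0 * (1 - s).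
Proof.
have -> : d - c = - c - - d by rewrite opprK addrC.
exact: (front_gap p1 pp' fr_neg (FZ c) (FZ d) s_in').
Qed.

Let growY c : (c - H) * s <= phi c.
Proof.
apply: (front_growth p1 pp' f_neg (FY c)); first exact: ltW.
move=> t; rewrite in_itv/= => /andP[? ?]; apply: (le_trans (ler_norm _)); apply: h_bnd.
by apply/andP; move: s0 s1; split; lra.
Qed.

Let growZ c : (- c - H) * (1 - s) <= psi c.
Proof.
apply: (front_growth p1 pp' fr_neg (FZ c)); first exact: ltW.
move=> t; rewrite in_itv/= => /andP[? ?]; apply: (le_trans (ler_norm _)).
by rewrite normrN; apply: h_bnd; apply/andP; move: s0 s1; split; lra.
Qed.

Let H0 : 0 <= H.
Proof. by apply: (le_trans (normr_ge0 (h 0))); apply: h_bnd; rewrite lexx ler01. Qed.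

Let gauge_eq_nonneg (x y : R -> R) t u : 0 <= x t -> 0 <= y u ->
  gauge p x t = gauge p y u -> x t = y u.
Proof.
move=> xt yu; rewrite /gauge !(max_idPl _)// => e.
by apply: (powR_injective be0); rewrite ?nnegrE.
Qed.

(** The intermediate value theorem for [phi - psi], which is 1-Lipschitz because
    the two intervals have total length 1. *)
Let matching : exists c, Y c s = Z c (1 - s).
Proof.
pose D c := phi c - psi c.
have Dlip x y : `|D x - D y| <= 1 * `|x - y|.
  have key u v : u <= v -> 0 <= D v - D u <= v - u.
    move=> uv; have := gapY u v; have := gapY v u; have := gapZ u v; have := gapZ v u.
    have -> : Num.max (u - v) 0 = 0 by apply/max_idPr; rewrite subr_le0.
    have -> : Num.max (v - u) 0 = v - u by apply/max_idPl; rewrite subr_ge0.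
    rewrite !mul0r /D mulrBr mulr1.
    move: (phi u) (phi v) (psi u) (psi v) => phiu phiv psiu psiv h1 h2 h3 h4.
    by apply/andP; split; lra.
  rewrite mul1r; have [xy|/ltW yx] := leP x y.
    have /andP[D0 D1] := key x y xy.
    by rewrite distrC (distrC x) (ger0_norm D0) (le_trans D1)// ler_norm.
  by have /andP[D0 D1] := key y x yx; rewrite (ger0_norm D0) (le_trans D1)// ler_norm.
have cD : continuous D by exact: lipschitz_continuous Dlip.
have psi0 : 0 <= psi 0 by exact: powR_ge0.
have phi0 : 0 <= phi 0 by exact: powR_ge0.
(* By the linear growth of the gauges, [phi M >= psi 0 >= psi M] and
   [psi (- N) >= phi 0 >= phi (- N)]. *)
pose M := H + psi 0 / s; pose N := H + phi 0 / (1 - s).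
have M0 : 0 <= M by rewrite addr_ge0 ?divr_ge0// ltW.
have N0 : 0 <= N by rewrite addr_ge0 ?divr_ge0// ltW.
have DM : 0 <= D M.
  have := growY M; rewrite /M addrAC subrr add0r divfK ?gt_eqF// => hY.
  have := gapZ M 0; rewrite sub0r (max_idPr _) ?oppr_le0// mul0r subr_le0.
  by rewrite subr_ge0 => hZ; apply: le_trans hY.
have DN : D (- N) <= 0.
  have := growZ (- N); rewrite opprK /N addrAC subrr add0r divfK ?gt_eqF// => hZ.
  have := gapY (- N) 0; rewrite subr0 (max_idPr _) ?oppr_le0// mul0r subr_le0.
  by rewrite subr_le0 => hY; exact: le_trans hZ.
have [|||c _ Dc] := @IVT R D (- N) M 0.
- by rewrite (le_trans _ M0)// oppr_le0.
- exact: continuous_subspaceT.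
- apply/andP; split.
    by rewrite ge_min; apply/orP; left; exact: DN.
  by rewrite le_max; apply/orP; right; exact: DM.
exists c; apply: gauge_eq_nonneg.
- exact: (front_end_ge0 (FY c)).
- exact: (front_end_ge0 (FZ c)).
- by apply/eqP; rewrite -subr_eq0; apply/eqP.
Qed.

Lemma speed_F_setP c : (exists y, positive_solution (wave_rhs p p' f h c) 0 s y) <-> Y c s = 0.
Proof.
split=> [[y [acy dy y0 ys yp]]|Ys].
  by rewrite -ys; apply: (front_unique p1 pp' f_neg (FY c)) => //; split.
by have [? ? ? ?] := FY c; exists (Y c); split.
Qed.

Lemma speed_B_setP c : (exists y, positive_solution (wave_rhs p p' f h c) s 1 y) <->
  Z c (1 - s) = 0.
Proof.
split=> [[y [acy dy ys y1 yp]]|Zs].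
  have B : back_front p p' f h s c y by split.
  have := front_unique p1 pp' fr_neg (FZ c) (front_of_back B) s1' s_in'.
  by rewrite subKr ys.
have [? ? ? ?] := back_of_front (FZ c).
by exists (fun t => Z c (1 - t)); split.
Qed.

(** On positive functions the truncation at zero in the equation is invisible,
    and the single point [s] does not matter almost everywhere, so a solution on
    [0, 1] is a pair of fronts agreeing at [s]. *)
Lemma wave_solutionP c y :
  positive_solution (wave_rhs_pos p p' f h c) 0 1 y <->
  [/\ front p p' f h s c y, back_front p p' f h s c y & 0 < y s].
Proof.
split=> [[acy dy y0 y1 yp]|[[acy dy y0 yp] [acy' dy' y1 yp'] ys]].
  have yp1 t : t \in `]0, s[ -> 0 < y t.
    by rewrite in_itv/= => /andP[? ?]; apply: yp; rewrite in_itv/=; apply/andP; move: s0 s1; split; lra.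
  have yp2 t : t \in `]s, 1[ -> 0 < y t.
    by rewrite in_itv/= => /andP[? ?]; apply: yp; rewrite in_itv/=; apply/andP; move: s0 s1; split; lra.
  split; last by apply: yp; rewrite in_itv/= s0.
  - split => //; first by apply: absolutely_continuousS acy => //; exact: ltW.
    apply: ae_impl dy => t dt ts; have yt := yp1 t ts.
    move: ts; rewrite in_itv/= => /andP[? ?].
    have : t \in `]0, 1[ by rewrite in_itv/=; apply/andP; move: s0 s1; split; lra.
    by move=> /dt; rewrite /wave_rhs_pos (max_idPl (ltW yt)).
  - split => //; first by apply: absolutely_continuousS acy => //; exact: ltW.
    apply: ae_impl dy => t dt ts; have yt := yp2 t ts.
    move: ts; rewrite in_itv/= => /andP[? ?].
    have : t \in `]0, 1[ by rewrite in_itv/=; apply/andP; move: s0 s1; split; lra.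
    by move=> /dt; rewrite /wave_rhs_pos (max_idPl (ltW yt)).
have y01 t : t \in `]0, 1[ -> 0 < y t.
  rewrite in_itv/= => /andP[t0 t1]; have [ts|ts|->//] := ltgtP t s.
    by apply: yp; rewrite in_itv/= t0.
  by apply: yp'; rewrite in_itv/= ts.
split => //.
  have := absolutely_continuous_glue (ltW s0) (ltW s1) (erefl (y s)) acy acy'.
  by congr absolutely_continuous; apply/funext => t; case: ifP.
have ae_s : {ae (@lebesgue_measure R), forall t : R, t != s}.
  exists [set s]; split => //; first exact: lebesgue_measure_set1.
  by move=> t /= /negP; rewrite negbK => /eqP.
have dd : {ae (@lebesgue_measure R), forall t, t \in `]0, 1[ -> t != s ->
    is_derive t 1 y (wave_rhs p p' f h c t (y t))}.
  apply: ae_impl2 dy dy' => t dt dt'; rewrite in_itv/= => /andP[t0 t1].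
  have [ts _|ts _|//] := ltgtP t s.
    by apply: dt; rewrite in_itv/= t0.
  by apply: dt'; rewrite in_itv/= ts.
apply: ae_impl2 ae_s dd => t ts dt tb.
by rewrite /wave_rhs_pos (max_idPl (ltW (y01 t tb))); exact: dt.
Qed.

Theorem wave_speed_criterion :
  (exists c : R, exists y : R -> R,
     positive_solution (wave_rhs_pos p p' f h c) 0 1 y /\
     (forall z : R -> R,
        positive_solution (wave_rhs_pos p p' f h c) 0 1 z ->
        forall t, t \in `[0, 1] -> z t = y t))
  <-> (speed_F p p' s f h < speed_B p p' s f h)%E.
Proof.
split=> [[c [y [/wave_solutionP[Fy By ys] _]]]|FB].
  have G0 : 0 < gauge p y s by rewrite powR_gt0// (max_idPl (ltW ys)).
  apply: (@lt_le_trans _ _ c%:E).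
    apply: (@le_lt_trans _ _ (c - gauge p y s / s)%:E); last first.
      by rewrite lte_fin gtrBl divr_gt0.
    apply: ge_ereal_sup => _ [c' /speed_F_setP Yc' <-].
    rewrite lee_fin lerBrDr -lerBrDl ler_pdivrMr//.
    have := front_gap p1 pp' f_neg Fy (FY c') s_in.
    rewrite [gauge p (Y c') s]/gauge Yc' maxxx powR0 ?gt_eqF// subr0.
    have [cc|cc] := leP (c - c') 0; last by [].
    by rewrite mul0r leNgt G0.
  apply: le_ereal_inf_tmp => _ [c' /speed_B_setP Zc' <-].
  rewrite lee_fin leNgt; apply/negP => cc.
  have := front_gap p1 pp' fr_neg (front_of_back By) (FZ c') s_in'.
  rewrite [gauge p (Z c') _]/gauge Zc' maxxx powR0 ?gt_eqF// subr0.
  rewrite (max_idPr _) ?mul0r; last by rewrite opprK addrC subr_le0 ltW.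
  by rewrite /gauge subKr leNgt G0.
have [c YZ] := matching.
have FYc := FY c; have BZ := back_of_front (FZ c).
have Ys : 0 < Y c s.
  rewrite lt_neqAle (front_end_ge0 FYc)// andbT; apply/eqP => Ys.
  suff : (speed_B p p' s f h <= speed_F p p' s f h)%E by rewrite leNgt FB.
  apply: (@le_trans _ _ c%:E).
    apply: ereal_inf_lbound; exists c => //; apply/speed_B_setP.
    by rewrite -YZ.
  by apply: ereal_sup_ubound; exists c => //; apply/speed_F_setP.
pose y t := if t <= s then Y c t else Z c (1 - t).
have yF : front p p' f h s c y.
  have yY t : t <= s -> Y c t = y t by rewrite /y => ->.
  have [acY dY Y0 Yp] := FYc; split.
  - by apply: absolutely_continuous_ext acY => t /andP[_ ts]; exact: yY.
  - by apply: ae_solution_ext dY => t; rewrite in_itv/= => /andP[_ /ltW]; exact: yY.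
  - by rewrite -yY// ltW.
  - by move=> t ts; rewrite -yY ?Yp// ltW// (itvP ts).
have yB : back_front p p' f h s c y.
  have yZ t : s <= t -> Z c (1 - t) = y t.
    by rewrite /y le_eqVlt => /predU1P[<-|st]; [rewrite lexx|rewrite leNgt st].
  have [acZ dZ Z0 Zp] := BZ; split.
  - by apply: absolutely_continuous_ext acZ => t /andP[st _]; exact: yZ.
  - by apply: ae_solution_ext dZ => t; rewrite in_itv/= => /andP[/ltW st _]; exact: yZ.
  - by rewrite -yZ// ltW.
  - by move=> t ts; rewrite -yZ ?Zp// ltW// (itvP ts).
exists c, y; split; first by apply/wave_solutionP; split => //; rewrite /y lexx.
move=> z /wave_solutionP[Fz Bz _] t; rewrite in_itv/= => /andP[t0 t1].
have [ts|/ltW st] := leP t s.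
  by apply: (front_unique p1 pp' f_neg Fz yF) => //; rewrite t0.
have t_in : 0 <= 1 - t <= 1 - s by apply/andP; move: s0 s1; split; lra.
have := front_unique p1 pp' fr_neg (front_of_back Bz) (front_of_back yB) s1' t_in.
by rewrite subKr.
Qed.
End matching_fronts.

Unset Implicit Arguments.
Set Strict Implicit.
Set Printing Implicit Defensive.

Theorem proposition6p1 (R : realType) (p p' s : R) (f h : R -> R)
    (q : nat) (k : nat -> R)
    (hp : 1 < p) (hpp' : p^-1 + p'^-1 = 1)
    (hs : 0 < s < 1)
    (f_int : (@lebesgue_measure R).-integrable `]0, 1[ (EFin \o f))
    (f0 : f 0 = 0) (fs : f s = 0) (f1 : f 1 = 0)
    (f_neg : forall t, t \in `]0, s[ -> f t < 0)
    (f_pos : forall t, t \in `]s, 1[ -> 0 < f t)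
    (f_usc : usc_on `]0, s[ f)
    (f_lsc : lsc_on `]s, 1[ f)
    (f_ge0 : 0 <= \int[@lebesgue_measure R]_(t in `]0, 1[) f t)
    (h_bounded : [bounded h t | t in `[0, 1]])
    (h_cont_s : {for s, continuous h})
    (k0 : k 0%N = 0) (k1 : k q.+1 = 1)
    (k_incr : forall j, (j <= q)%N -> k j < k j.+1)
    (h_jump : forall j, (1 <= j <= q)%N -> discontinuity h (k j))
    (h_cont : forall j, (j <= q)%N -> {in `]k j, k j.+1[, continuous h}) :
  (exists c : R, exists y : R -> R,
     positive_solution (wave_rhs_pos p p' f h c) 0 1 y /\
     (forall z : R -> R,
        positive_solution (wave_rhs_pos p p' f h c) 0 1 z ->
        forall t, t \in `[0, 1] -> z t = y t))
  <-> (speed_F p p' s f h < speed_B p p' s f h)%E.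
Proof.
have /andP[s0 s1] := hs.
have [H [_ hH]] := h_bounded.
have h_bnd t : 0 <= t <= 1 -> `|h t| <= H + 1.
  by move=> t01; apply: hH; [rewrite ltrDl|rewrite /= in_itv].
have h_meas : measurable_fun (`]0, 1[%classic : set R) h.
  have := piecewise_continuous_measurable h_cont.
  by rewrite k0 k1.
exact: (wave_speed_criterion hp hpp' s0 s1 f_int f_neg f_pos f_usc f_lsc h_bnd h_meas).
Qed.
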